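(* Let $f$ be a positive operator monotone function defined in the positive half-line $(0,\infty)$. There is a bounded positive measure $\mu$ on the closed extended half-line $[0,\infty]$ such that \[ f(t)=\int_0^\infty\frac{t(1+\lambda)}{t+\lambda}\,d\mu(\lambda)\qquad t>0. \] Conversely, any function given in this form (with $\mu$ a bounded positive measure on $[0,\infty]$) is operator monotone. The measure $\mu$ is a probability measure if and only if $f(1)=1$.
   Context: For a function $f\colon I\to\mathbf R$ on an interval $I$ and a hermitian matrix $x$ with spectrum in $I$, $f(x)$ is defined by the functional calculus (spectral theorem). The function $f$ is $n$-monotone if $x\le y$ implies $f(x)\le f(y)$ for every pair of $n\times n$ hermitian matrices $x,y$ with spectra in $I$, where $\le$ is the order given by positive semi-definiteness of the difference. It is operator monotone if it is $n$-monotone for all natural numbers $n$. A positive function takes values in $(0,\infty)$. Measures are Borel measures; the integral is over the whole compact extended half-line $[0,\infty]$ including possible atoms at $0$ and $\infty$, and the integrand $\frac{t(1+\lambda)}{t+\lambda}$ is given its limit value $t$ at $\lambda=\infty$. *)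

(* Defs.v *)
From HB Require Import structures.
From mathcomp Require Import all_boot all_order all_algebra.
From mathcomp Require Import complex.
From mathcomp Require Import all_classical all_reals all_analysis measurable_realfun.

Set Implicit Arguments.
Unset Strict Implicit.
Unset Printing Implicit Defensive.

Import Order.TTheory GRing.Theory Num.Theory Num.Def.
Local Open Scope classical_set_scope.
Local Open Scope ring_scope.
Local Open Scope sesquilinear_scope.

Section OperatorMonotone.
Context {R : realType}.

Definition spectrum_in n (I : interval R) (x : 'M[R[i]]_n) : Prop :=
  forall a : R[i], eigenvalue x a -> exists2 r : R, r \in I & a = r%:C%C.

(* Only the values of f on the spectrum matter, so a function on an interval I
   is represented by a total f whose values off I are irrelevant. *)
Definition fun_calc n (f : R -> R) (x : 'M[R[i]]_n) : 'M[R[i]]_n :=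
  invmx (spectralmx x)
    *m diag_mx (map_mx (fun z : R[i] => (f (complex.Re z))%:C%C)
                       (spectral_diag x))
    *m spectralmx x.

(* fun_calc does not depend on the diagonalization picked by spectralmx. *)
Lemma fun_calcE n (f : R -> R) (x u : 'M[R[i]]_n) (d : 'rV[R]_n) :
  u \is unitarymx ->
  x = invmx u *m diag_mx (map_mx (fun r => r%:C%C) d) *m u ->
  fun_calc f x = invmx u *m diag_mx (map_mx (fun r => (f r)%:C%C) d) *m u.
Proof.
move=> uU xE; have uu := unitarymx_unit uU.
have xn : x \is normalmx.
  by apply/orthomx_spectral_subproof; exists (u, map_mx (fun r => r%:C%C) d).
have xP := orthomx_spectralP xn; have pu := spectral_unit x.
rewrite /fun_calc; set p := spectralmx x in xP pu *.
set e := spectral_diag x in xP *.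
pose w := p *m invmx u.
have weq : w *m diag_mx (map_mx (fun r => r%:C%C) d) = diag_mx e *m w.
  have -> : w *m diag_mx (map_mx (fun r => r%:C%C) d) = p *m x *m invmx u.
    by rewrite xE /w !mulmxA mulmxK.
  by rewrite xP /w !mulmxA mulmxV// mul1mx.
suff fweq : w *m diag_mx (map_mx (fun r => (f r)%:C%C) d) =
    diag_mx (map_mx (fun z : R[i] => (f (complex.Re z))%:C%C) e) *m w.
  have pE : p = w *m u by rewrite /w mulmxKV.
  have wE : invmx p *m w = invmx u by rewrite /w mulKmx.
  by rewrite [X in _ *m _ *m X = _]pE mulmxA -[invmx p *m _ *m w]mulmxA -fweq
             [invmx p *m (w *m _)]mulmxA wE.
clearbody w; apply/matrixP => i j; move/matrixP: weq => /(_ i j).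
rewrite !mul_mx_diag !mul_diag_mx !mxE.
have [->|w0] := eqVneq (w i j) 0; first by rewrite !mul0r !mulr0.
by rewrite mulrC => /(mulIf w0) <-; rewrite mulrC.
Qed.

Definition psdmx n (x : 'M[R[i]]_n) : Prop :=
  x \is hermsymmx /\ forall v : 'cV[R[i]]_n, 0 <= (v^t* *m x *m v) 0 0.

Definition lemx n (x y : 'M[R[i]]_n) : Prop := psdmx (y - x).

Definition n_monotone (n : nat) (I : interval R) (f : R -> R) : Prop :=
  forall x y : 'M[R[i]]_n,
    x \is hermsymmx -> y \is hermsymmx ->
    spectrum_in I x -> spectrum_in I y ->
    lemx x y -> lemx (fun_calc f x) (fun_calc f y).

Definition operator_monotone (I : interval R) (f : R -> R) : Prop :=
  forall n : nat, n_monotone n I f.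

(* The integrand t(1+l)/(t+l), extended by its limit t at l = +oo; the value at
   -oo is a dummy. *)
Definition kernel_fun (t : R) (l : \bar R) : R :=
  match l with
  | r%:E%E => t * (1 + r) / (t + r)
  | +oo%E => t
  | -oo%E => 0
  end.

Definition ext_halfline : set (\bar R) := [set` `[0%E, +oo%E]].

(* A bounded Borel measure on [0, +oo] is given as a finite measure on \bar R
   (with its Borel sigma-algebra) that vanishes outside [0, +oo]. *)
Definition on_ext_halfline (mu : {finite_measure set (\bar R) -> \bar R}) :
    Prop :=
  mu (~` ext_halfline) = 0%E.

Definition represents (mu : {finite_measure set (\bar R) -> \bar R})
    (f : R -> R) : Prop :=
  forall t : R, 0 < t ->
    (f t)%:E = (\int[mu]_(l in ext_halfline) (kernel_fun t l)%:E)%E.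

End OperatorMonotone.

(* Main.v *)
From HB Require Import structures.
Require Import Defs.
From mathcomp Require Import all_boot all_order all_algebra.
From mathcomp Require Import complex polyrcf ring lra zify.
From mathcomp Require Import all_classical all_reals all_analysis measurable_realfun.

(* For the integral representation no smoothness of [f] is needed.  For nodes
   x_1 < y_1 < ... < x_m < y_m, a rank one perturbation of diag(x) has spectrum
   y; testing monotonicity of [f] on this pair against a suitable vector says
   exactly that the divided difference of [f b^2] over the 2m nodes is
   nonnegative for every polynomial [b] of degree < m.  Adding a node near 0 and
   a node near infinity, the same follows with the opposite sign for [f(t)/t].
   A polynomial nonnegative on [0, oo) is a sum of terms a^2 and X b^2, so a
   linear combination of kernels that is nonnegative on [0, oo] has a nonnegative
   value when each kernel k_t is replaced by f(t).  By Hahn-Banach the functional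
   k_t |-> f(t) extends to a positive functional on bounded functions; its values
   on indicators of [0, x] form a distribution function, and the law of the
   corresponding quantile function is the measure.
   Conversely, <x (x + r)^-1 v, v> is the minimum over w of an expression
   monotone in x, and the inequality integrates over the measure. *)

Set Implicit Arguments.
Unset Strict Implicit.
Unset Printing Implicit Defensive.

Import Order.TTheory GRing.Theory Num.Theory Num.Def.
Local Open Scope classical_set_scope.
Local Open Scope ring_scope.

(** * Polynomials nonnegative on the half-line *)

(* [2 * size a <= d.+2] says that [a ^+ 2] has degree at most [d], and
   [2 * size b <= d.+1] that ['X * b ^+ 2] does. *)
Inductive pos_cone (F : rcfType) (d : nat) : {poly F} -> Prop :=
| PosCone0 : pos_cone d 0
| PosConeSqr (a p : {poly F}) : (2 * size a <= d.+2)%N -> pos_cone d p ->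
    pos_cone d (a ^+ 2 + p)
| PosConeXSqr (b p : {poly F}) : (2 * size b <= d.+1)%N -> pos_cone d p ->
    pos_cone d ('X * b ^+ 2 + p).

Section PosCone.
Variable F : rcfType.
Implicit Types (p q a b : {poly F}) (d e : nat).

Lemma size_mul_double n a b : (2 * (size a + size b).-1 <= n)%N ->
  (2 * size (a * b)%R <= n)%N.
Proof. by apply: leq_trans; rewrite leq_mul2l/= size_polyMleq. Qed.

Lemma pos_coneD d p q : pos_cone d p -> pos_cone d q -> pos_cone d (p + q).
Proof.
move=> + qd; elim=> [|a {}p ad _ IH|b {}p bd _ IH]; first by rewrite add0r.
- by rewrite -addrA; exact: PosConeSqr.
- by rewrite -addrA; exact: PosConeXSqr.
Qed.

Lemma pos_coneM_sqr d e a p : (2 * size a <= e.+2)%N -> pos_cone d p ->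
  pos_cone (d + e) (a ^+ 2 * p).
Proof.
move=> ae; elim=> [|c {}p cd _ IH|b {}p bd _ IH]; first by rewrite mulr0; constructor.
- rewrite mulrDr -exprMn; apply: PosConeSqr => //.
  by apply: size_mul_double; lia.
- rewrite mulrDr mulrCA -exprMn; apply: PosConeXSqr => //.
  by apply: size_mul_double; lia.
Qed.

(** Two terms carrying a factor ['X] multiply to a single square, that of ['X * (a * b)]; the degree
    bounds still add up. *)
Lemma pos_coneM_Xsqr d e a p : (2 * size a <= e.+1)%N -> pos_cone d p ->
  pos_cone (d + e) ('X * a ^+ 2 * p).
Proof.
move=> ae; elim=> [|c {}p cd _ IH|b {}p bd _ IH]; first by rewrite mulr0; constructor.
- rewrite mulrDr -mulrA -exprMn; apply: PosConeXSqr => //.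
  by apply: size_mul_double; lia.
- rewrite mulrDr; have -> : 'X * a ^+ 2 * ('X * b ^+ 2) = ('X * (a * b)) ^+ 2.
    by rewrite !exprMn; ring.
  apply: PosConeSqr => //; apply: size_mul_double; rewrite size_polyX.
  by have := size_polyMleq a b; move: ae bd; move: (size a) (size b) (size (a * b)%R); lia.
Qed.

Lemma pos_coneM d e p q : pos_cone d p -> pos_cone e q -> pos_cone (d + e) (p * q).
Proof.
rewrite addnC => + qe; elim=> [|a {}p ad _ IH|b {}p bd _ IH].
- by rewrite mul0r; constructor.
- by rewrite mulrDl; apply: pos_coneD => //; exact: pos_coneM_sqr.
- by rewrite mulrDl; apply: pos_coneD => //; exact: pos_coneM_Xsqr.
Qed.

Lemma pos_coneC d (c : F) : 0 <= c -> pos_cone d c%:P.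
Proof.
move=> c0; rewrite -(sqr_sqrtr c0) polyC_exp -[_ ^+ 2]addr0.
apply: PosConeSqr; last by constructor.
by rewrite (leq_trans (leq_mul (leqnn 2) (size_polyC_leq1 _))).
Qed.

Lemma pos_cone_leq d e p : (d <= e)%N -> pos_cone d p -> pos_cone e p.
Proof.
move=> de; elim=> [|a {}p ad _ IH|b {}p bd _ IH]; constructor => //; lia.
Qed.

Lemma pos_cone_XaddC (s : F) : 0 <= s -> pos_cone 1 ('X + s%:P).
Proof.
move=> s0; apply: pos_coneD; last exact: pos_coneC.
rewrite -['X]mulr1 -[1](expr1n _ 2) -[_ * _]addr0.
by apply: PosConeXSqr; [rewrite size_poly1|constructor].
Qed.

Lemma pos_cone_sqrXsubC (s : F) : pos_cone 2 (('X - s%:P) ^+ 2).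
Proof.
by rewrite -[_ ^+ 2]addr0; apply: PosConeSqr; [rewrite size_XsubC|constructor].
Qed.

(** By continuity a negative value at [c] would persist on a whole neighbourhood. This passes
    inequalities to limit points without any topology on polynomials. *)
Lemma horner_ge0_closure p c :
  (forall e : F, 0 < e -> exists2 x, `|x - c| < e & 0 <= p.[x]) -> 0 <= p.[c].
Proof.
move=> H; rewrite leNgt; apply/negP => pc.
have [e e0 /= He] := poly_cont c p (ltac:(rewrite oppr_gt0; exact: pc) : 0 < - p.[c]).
have [x /He + px] := H e e0; rewrite ltNge => /negP; apply.
by rewrite ger0_norm; lra.
Qed.

(** A positive root is interior to the half-line, so [p] keeps its sign across it. The cofactor is
    therefore [<= 0] on the left and [>= 0] on the right, and vanishes at [r]. *)
Lemma nneg_double_root p (r : F) : 0 < r -> root p r ->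
  (forall x, 0 <= x -> 0 <= p.[x]) -> exists q, p = ('X - r%:P) ^+ 2 * q.
Proof.
move=> r0 /factor_theorem[q ->] pq.
suff /factor_theorem[q' ->] : root q r by exists q'; ring.
rewrite rootE eq_le; apply/andP; split.
  rewrite -oppr_ge0 -hornerN; apply: horner_ge0_closure => e e0.
  (* The second argument of the minimum keeps the point in the half-line, where [p] is known to be
     nonnegative. *)
  exists (r - Num.min (e / 2) (r / 2)); first by rewrite addrAC subrr add0r normrN ger0_norm ?le_min ?gt_min; lra.
  have := pq (r - Num.min (e / 2) (r / 2)); set m := Num.min _ _.
  have m0 : 0 < m by rewrite lt_min; lra.
  have mr : m <= r / 2 by rewrite ge_min lexx orbT.
  rewrite hornerM hornerXsubC hornerN => /(_ ltac:(lra)).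
  by rewrite addrAC subrr add0r mulrN -mulNr pmulr_lge0.
apply: horner_ge0_closure => e e0; exists (r + e / 2).
  by rewrite addrAC subrr add0r ger0_norm; lra.
have := pq (r + e / 2) ltac:(lra).
by rewrite hornerM hornerXsubC addrAC subrr add0r pmulr_lge0//; lra.
Qed.

Lemma nneg_quotient p q (c : F) : (forall x, 0 <= x -> x != c -> 0 < q.[x]) ->
  (forall x, 0 <= x -> 0 <= (q * p).[x]) -> forall x, 0 <= x -> 0 <= p.[x].
Proof.
move=> q0 pq.
have H x : 0 <= x -> x != c -> 0 <= p.[x].
  by move=> x0 xc; have := pq x x0; rewrite hornerM pmulr_rge0// q0.
move=> x; have [->|xc] := eqVneq x c => x0; last exact: H.
apply: horner_ge0_closure => e e0; exists (c + e / 2).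
  by rewrite addrAC subrr add0r ger0_norm; lra.
by apply: H; [lra|rewrite -subr_eq0 addrAC subrr add0r; lra].
Qed.

(** The remainder modulo the minimal polynomial of [a + ib] is affine and vanishes at [a + ib]. Its
    imaginary part there is the slope times [b], so the slope is zero, and then so is the
    constant. *)
Lemma quadratic_factor p (a b : F) : b != 0 ->
  root (map_poly (real_complex F) p) (a +i* b)%C ->
  exists q, p = (('X - a%:P) ^+ 2 + (b ^+ 2)%:P) * q.
Proof.
move=> b0 rp; set g := _ + _.
have sg : size g = 3.
  rewrite size_polyDl; rewrite size_exp_XsubC// size_polyC; by case: eqP.
have gz : (map_poly (real_complex F) g).[(a +i* b)%C] = 0.
  rewrite /g rmorphD/= rmorphXn/= rmorphB/= map_polyX !map_polyC/=.
  rewrite !hornerE; apply/eqP; rewrite eq_complex/=.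
  by apply/andP; split; apply/eqP; ring.
have : (map_poly (real_complex F) (p %% g)).[(a +i* b)%C] = 0.
  have := rp; rewrite rootE {1}(divp_eq p g) rmorphD rmorphM/= hornerD hornerM.
  by rewrite gz mulr0 add0r => /eqP.
have g0 : g != 0 by rewrite -size_poly_gt0 sg.
have sr : (size (p %% g)%R <= 2)%N by have := ltn_modpN0 p g0; rewrite sg.
have rE : p %% g = (p %% g)`_1 *: 'X + ((p %% g)`_0)%:P.
  apply/polyP => -[|[|k]]; rewrite coefD coefZ coefX coefC ?mulr0 ?mulr1 ?add0r ?addr0//=.
  by rewrite nth_default// (leq_trans sr).
rewrite rE; set c1 := _`_1 in rE *; set c0 := _`_0 in rE *.
rewrite rmorphD/= map_polyZ/= map_polyX map_polyC/= !hornerE => /eqP.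
rewrite eq_complex/= !mul0r subr0 !addr0 mulf_eq0 (negPf b0) orbF => /andP[+ c10].
rewrite (eqP c10) mul0r add0r => c00.
exists (p %/ g); rewrite {1}(divp_eq p g) rE (eqP c10) (eqP c00).
by rewrite scale0r !addr0 mulrC.
Qed.

(** Induction on the size, splitting off a factor at a complex root: a positive quadratic for a
    nonreal root, a square for a positive root, ['X - a] for a root [a <= 0]. Each factor lies in
    the cone and leaves a nonnegative quotient, and the degrees add exactly. *)
Lemma pos_coneP p : (forall x, 0 <= x -> 0 <= p.[x]) -> pos_cone (size p).-1 p.
Proof.
have [n] := ubnP (size p); elim: n p => // n IH p sp p0.
have [s1|s1] := leqP (size p) 1.
  rewrite (size1_polyC s1); apply: pos_coneC.
  by have := p0 0 (lexx _); rewrite (size1_polyC s1) hornerC coefC.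
have [[a b] rz] : exists z, root (map_poly (real_complex F) p) z.
  by apply/closed_rootP; rewrite size_map_poly gtn_eqF.
have step q g : p = g * q -> (1 < size g)%N -> pos_cone (size g).-1 g ->
   (forall x, 0 <= x -> 0 <= q.[x]) -> pos_cone (size p).-1 p.
  move=> pE sg pg q0.
  have g0 : g != 0 by rewrite -size_poly_gt0 ltnW.
  have qn0 : q != 0 by apply: contraTneq s1 => q_0; rewrite pE q_0 mulr0 size_poly0.
  have sq : (0 < size q)%N by rewrite size_poly_gt0.
  have spE : size p = (size g + size q).-1 by rewrite pE size_mul.
  have -> : (size p).-1 = ((size g).-1 + (size q).-1)%N by rewrite spE; lia.
  by rewrite pE; apply: pos_coneM => //; apply: IH => //; move: sp; rewrite spE; lia.
have [b0|b0] := eqVneq b 0; last first.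
  have [q pE] := quadratic_factor b0 rz.
  have sg : size (('X - a%:P) ^+ 2 + (b ^+ 2)%:P) = 3.
    by rewrite size_polyDl size_exp_XsubC// size_polyC; case: eqP.
  have gpos x : 0 < (('X - a%:P) ^+ 2 + (b ^+ 2)%:P).[x].
    by rewrite !hornerE ltr_wpDl ?sqr_ge0// exprn_even_gt0.
  apply: (step q _ pE); rewrite ?sg//.
    by apply: pos_coneD; [exact: pos_cone_sqrXsubC|apply: pos_coneC; exact: sqr_ge0].
  (* The excepted point [-1] is arbitrary, since the quadratic factor is positive everywhere. *)
  apply: (@nneg_quotient _ _ (-1) (fun x _ _ => gpos x)).
  by move=> x x0; rewrite -pE; exact: p0.
have ra : root p a.
  by move: rz; rewrite b0 rootE complexr0 horner_map/= eq_complex/= eqxx andbT.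
have [a0|a0] := ltP 0 a.
  have [q pE] := nneg_double_root a0 ra p0.
  apply: (step q _ pE); rewrite ?size_exp_XsubC//.
    exact: pos_cone_sqrXsubC.
  apply: (@nneg_quotient _ (('X - a%:P) ^+ 2) a).
    by move=> x _ xa; rewrite !hornerE exprn_even_gt0//= subr_eq0.
  by move=> x x0; rewrite -pE; exact: p0.
have /factor_theorem[q pE] := ra.
have {}pE : p = ('X + (- a)%:P) * q by rewrite pE mulrC polyCN.
have sX : size ('X + (- a)%:P) = 2 by rewrite size_XaddC.
apply: (step q _ pE); rewrite ?sX//.
  by apply: pos_cone_XaddC; rewrite oppr_ge0.
apply: (@nneg_quotient _ ('X + (- a)%:P) a).
  by move=> x x0 xa; rewrite !hornerE lt_neqAle eq_sym subr_eq0 xa/=; lra.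
by move=> x x0; rewrite -pE; exact: p0.
Qed.

End PosCone.

(** * Diagonalization and test vectors *)

Section Diagonalization.
Local Open Scope sesquilinear_scope.
Context {R : realType}.
Implicit Types (n : nat) (I : interval R) (f : R -> R).

Definition unitary_diag n (u : 'M[R[i]]_n) (d : 'rV[R]_n) : 'M[R[i]]_n :=
  invmx u *m diag_mx (map_mx (fun r => r%:C%C) d) *m u.

Lemma conj_realC (r : R) : (r%:C%C : R[i])^* = r%:C%C.
Proof. exact: conjc_real. Qed.

Lemma unitary_diag_herm n (u : 'M[R[i]]_n) (d : 'rV[R]_n) : u \is unitarymx ->
  unitary_diag u d \is hermsymmx.
Proof.
move=> uU; apply/is_hermitianmxP; rewrite expr0 scale1r /unitary_diag.
rewrite (invmx_unitary uU) !trmx_mul !map_mxM/= map_trmx trmxK -map_mx_comp.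
have -> : map_mx (conjC \o conjC) u = u.
  by apply/matrixP => j k; rewrite !mxE/= conjCK.
rewrite mulmxA.
rewrite tr_diag_mx map_diag_mx -map_mx_comp.
have <- // : map_mx (fun r => r%:C%C) d = map_mx (conjC \o (fun r => r%:C%C)) d.
by apply/rowP => k; rewrite !mxE/= conj_realC.
Qed.

Lemma unitary_diag_spectrum n I (u : 'M[R[i]]_n) (d : 'rV[R]_n) : u \is unitarymx ->
  (forall k, d 0 k \in I) -> spectrum_in I (unitary_diag u d).
Proof.
move=> uU dI a /eigenvalueP[v vE v0]; have uu := unitarymx_unit uU.
pose w := v *m invmx u.
have w0 : w != 0.
  by apply: contra v0 => /eqP w0; rewrite -[v](mulmxKV uu) -/w w0 mul0mx.
have /rV0Pn[k wk] := w0.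
exists (d 0 k) => //; apply: (mulIf wk).
have /rowP/(_ k) : w *m diag_mx (map_mx (fun r => r%:C%C) d) = a *: w.
  by rewrite /w scalemxAl -vE /unitary_diag !mulmxA mulmxK.
by rewrite mul_mx_diag !mxE => <-; rewrite mulrC.
Qed.

(** The rows of [spectralmx x] are eigenvectors, so each entry of [spectral_diag x] is an eigenvalue
    and [spectrum_in] makes it a real number of [I]. *)
Lemma herm_unitary_diag n I (x : 'M[R[i]]_n) : x \is hermsymmx ->
  spectrum_in I x ->
  exists u d, [/\ u \is unitarymx, x = unitary_diag u d & forall k, d 0 k \in I].
Proof.
move=> xh xI; have xn := hermitian_normalmx xh.
have xP := orthomx_spectralP xn; have pu := spectral_unit x.
have ev k : eigenvalue x (spectral_diag x 0 k).
  apply/eigenvalueP; exists (delta_mx 0 k *m spectralmx x).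
    rewrite {2}xP !mulmxA mulmxK// scalemxAl; congr (_ *m _).
    by apply/rowP => j; rewrite mul_mx_diag !mxE eqxx/= mulrC; case: eqP => [->|]; rewrite ?mulr0.
  apply/eqP => /(congr1 (mulmx^~ (invmx (spectralmx x)))).
  rewrite mulmxK// mul0mx => /rowP/(_ k); rewrite !mxE !eqxx/=.
  by move/eqP; rewrite oner_eq0.
pose d : 'rV[R]_n := \row_k complex.Re (spectral_diag x 0 k).
exists (spectralmx x), d; split; first exact: spectral_unitarymx.
  have E : map_mx (fun r => r%:C%C) d = spectral_diag x.
    by apply/rowP => k; rewrite !mxE; have [r _ ->] := xI _ (ev k).
  by rewrite /unitary_diag E.
by move=> k; rewrite mxE; have [r rI ->] := xI _ (ev k).
Qed.

Definition qform n (x : 'M[R[i]]_n) (v : 'cV[R[i]]_n) : R[i] :=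
  (v^t* *m x *m v) 0 0.

Lemma qformB n (x y : 'M[R[i]]_n) v : qform (y - x) v = qform y v - qform x v.
Proof. by rewrite /qform mulmxBr mulmxBl [LHS]mxE [X in _ + X]mxE. Qed.

Lemma unitary_diag_qform n (u : 'M[R[i]]_n) (d : 'rV[R]_n) (v : 'cV_n) : u \is unitarymx ->
  qform (unitary_diag u d) v =
  \sum_k (d 0 k)%:C%C * ((u *m v) k 0 * ((u *m v) k 0)^*).
Proof.
move=> uU; rewrite /qform /unitary_diag (invmx_unitary uU).
have -> : v^t* *m (u^t* *m diag_mx (map_mx (fun r => r%:C%C) d) *m u) *m v =
   (u *m v)^t* *m diag_mx (map_mx (fun r => r%:C%C) d) *m (u *m v).
  by rewrite trmx_mul map_mxM/= !mulmxA.
move: (u *m v) => w; rewrite mxE; apply: eq_bigr => k _.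
by rewrite mul_mx_diag !mxE [_ * _%:C%C]mulrC -mulrA [X in _ * X]mulrC.
Qed.

Lemma lemxP n (x y : 'M[R[i]]_n) : x \is hermsymmx -> y \is hermsymmx ->
  (lemx x y <-> forall v, qform x v <= qform y v).
Proof.
move=> xh yh; have E v : (v^t* *m (y - x) *m v) 0 0 = qform y v - qform x v by exact: qformB.
split=> [[_ H] v|H]; first by rewrite -subr_ge0 -E.
split=> [|v]; last by rewrite E subr_ge0.
apply/is_hermitianmxP; rewrite expr0 scale1r.
have /is_hermitianmxP := xh; have /is_hermitianmxP := yh.
by rewrite !expr0 !scale1r linearB/= map_mxB/= => <- <-.
Qed.

Lemma fun_calc_diag n f (u : 'M[R[i]]_n) (d : 'rV[R]_n) : u \is unitarymx ->
  fun_calc f (unitary_diag u d) = unitary_diag u (map_mx f d).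
Proof.
move=> uU; have E : map_mx (fun r => (f r)%:C%C) d = map_mx (fun r => r%:C%C) (map_mx f d).
  by apply/rowP => k; rewrite !mxE.
by rewrite (fun_calcE f uU (erefl (unitary_diag u d))) E.
Qed.

(** Monotonicity is applied to the complexifications of [diag x] and [diag x + v v^T], whose
    difference is positive semi-definite, and tested at the real vector [b]. As [u] is real
    orthogonal, both quadratic forms are real sums over the eigenvalues. *)
Lemma n_monotone_orthogonal n f (u : 'M[R]_n) (x y : 'rV[R]_n) (v : 'cV[R]_n)
    (b : 'cV[R]_n) : n_monotone n `]0, +oo[ f ->
  u *m u^T = 1%:M -> (forall k, 0 < x 0 k) -> (forall k, 0 < y 0 k) ->
  u^T *m diag_mx y *m u = diag_mx x + v *m v^T ->
  \sum_k f (x 0 k) * b k 0 ^+ 2 <= \sum_k f (y 0 k) * (u *m b) k 0 ^+ 2.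
Proof.
move=> fm uU x0 y0 E.
pose uc : 'M[R[i]]_n := map_mx (real_complex R) u.
have ucU : uc \is unitarymx.
  apply/unitarymxP; rewrite /uc.
  have -> : (map_mx (real_complex R) u)^t* = map_mx (real_complex R) u^T.
    by apply/matrixP => i j; rewrite !mxE/= conj_realC.
  by rewrite -map_mxM/= uU map_mx1.
have oU : (1%:M : 'M[R[i]]_n) \is unitarymx.
  by apply/unitarymxP; rewrite trmx1 map_mx1 mulmx1.
have in0 (r : R) : 0 < r -> r \in `]0, +oo[ by rewrite in_itv/= andbT.
have herm2 : unitary_diag 1%:M x \is hermsymmx /\ unitary_diag uc y \is hermsymmx.
  by split; apply: unitary_diag_herm.
have H := @fm _ _ herm2.1 herm2.2
  (unitary_diag_spectrum oU (fun k => in0 _ (x0 k)))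
  (unitary_diag_spectrum ucU (fun k => in0 _ (y0 k))).
have {}H : lemx (unitary_diag 1%:M (map_mx f x)) (unitary_diag uc (map_mx f y)).
  rewrite -(fun_calc_diag _ _ oU) -(fun_calc_diag _ _ ucU); apply: H; apply/lemxP; try exact: unitary_diag_herm.
  move=> z; rewrite -subr_ge0.
  have DE : unitary_diag uc y - unitary_diag 1%:M x =
      map_mx (real_complex R) v *m (map_mx (real_complex R) v)^t*.
    rewrite /unitary_diag (invmx_unitary ucU) invmx1 mul1mx mulmx1.
    have -> : (map_mx (real_complex R) v)^t* = map_mx (real_complex R) v^T.
      by apply/matrixP => i j; rewrite !mxE/= conj_realC.
    have -> : uc^t* = map_mx (real_complex R) u^T.
      by apply/matrixP => i j; rewrite !mxE/= conj_realC.
    rewrite -!map_diag_mx -!map_mxM/= E map_mxD/=.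
    by rewrite addrAC subrr add0r.
  rewrite -qformB DE /qform; set vc := map_mx _ v.
  have -> : z^t* *m (vc *m vc^t*) *m z = (z^t* *m vc) *m (z^t* *m vc)^t*.
    by rewrite trmx_mul map_mxM/= trmxCK !mulmxA.
  by rewrite mxE big_ord1 !mxE mul_conjC_ge0.
move: H => /(lemxP (unitary_diag_herm _ oU) (unitary_diag_herm _ ucU)).
move=> /(_ (map_mx (real_complex R) b)).
rewrite (unitary_diag_qform _ _ oU) (unitary_diag_qform _ _ ucU) mul1mx /uc -map_mxM/=.
rewrite -lecR !rmorph_sum/=; set l := (X in X <= _ -> _); set r := (X in _ <= X -> _).
have -> : l = \sum_k (f (x 0 k) * b k 0 ^+ 2)%:C%C.
  by apply: eq_bigr => k _; rewrite !mxE conj_realC !rmorphM/=.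
have -> // : r = \sum_k (f (y 0 k) * (u *m b) k 0 ^+ 2)%:C%C.
by apply: eq_bigr => k _; rewrite 3!mxE/= conj_realC !rmorphM/=.
Qed.

End Diagonalization.

(** * Interlacing nodes *)

Section Lagrange.
Variables (F : fieldType) (m : nat) (x : 'I_m -> F).
Hypothesis x_inj : injective x.

Lemma lagrange_prod_neq0 i : \prod_(k < m | k != i) (x i - x k) != 0.
Proof. by apply/prodf_neq0 => k ki; rewrite subr_eq0 inj_eq// eq_sym. Qed.

Lemma horner_prod_XsubC (P : pred 'I_m) z :
  (\prod_(k < m | P k) ('X - (x k)%:P)).[z] = \prod_(k < m | P k) (z - x k).
Proof. by rewrite horner_prod; apply: eq_bigr => k _; rewrite hornerXsubC. Qed.

Lemma lagrange_interpolation (p : {poly F}) : (size p <= m)%N ->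
  p = \sum_i (p.[x i] / \prod_(k < m | k != i) (x i - x k))
             *: \prod_(k < m | k != i) ('X - (x k)%:P).
Proof.
move=> sp; apply/eqP; rewrite -subr_eq0; apply/eqP.
apply: (@roots_geq_poly_eq0 _ _ (codom x)).
- apply/allP => _ /codomP[j ->]; rewrite rootE hornerD hornerN horner_sum.
  rewrite (bigD1 j)//= [X in _ - (_ + X)]big1 ?addr0 => [|i ij].
    rewrite hornerZ horner_prod_XsubC.
    by rewrite divfK ?subrr//; exact: lagrange_prod_neq0.
  rewrite hornerZ horner_prod_XsubC [X in _ * X](bigD1 j) 1?eq_sym//= subrr.
  by rewrite mul0r mulr0.
- by rewrite map_inj_uniq// enum_uniq.
- rewrite size_codom card_ord (leq_trans (size_polyD _ _))// geq_max sp/=.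
  rewrite size_polyN (leq_trans (size_sum _ _ _))//; apply/bigmax_leqP => i _.
  rewrite (leq_trans (size_scale_leq _ _))// size_prod => [|k _]; last by rewrite polyXsubC_eq0.
  under eq_bigr do rewrite size_XsubC.
  by have := ltn_ord i; rewrite sum_nat_const cardC1 card_ord; lia.
Qed.

(** Lagrange interpolation evaluated at [z] and divided by the node polynomial; all identities for
    the Cauchy matrix below reduce to it. *)
Lemma partial_fractions (p : {poly F}) z : (size p <= m)%N ->
  (forall i, z != x i) ->
  \sum_i p.[x i] / (\prod_(k < m | k != i) (x i - x k) * (z - x i)) =
  p.[z] / \prod_k (z - x k).
Proof.
move=> sp zx; have zxn0 i : z - x i != 0 by rewrite subr_eq0.
rewrite {2}(lagrange_interpolation sp) horner_sum mulr_suml.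
apply: eq_bigr => i _; rewrite hornerZ horner_prod_XsubC.
rewrite [X in _ = _ / X](bigD1 i)//= /=.
have prod_n0 : \prod_(k < m | k != i) (z - x k) != 0 by apply/prodf_neq0.
by field; rewrite zxn0 prod_n0 lagrange_prod_neq0.
Qed.

End Lagrange.

(** * Rank one perturbations with interlacing spectrum *)

Section Interlacing.
Variables (F : realType) (m : nat) (x y : 'I_m -> F).
Hypothesis xy : forall i j, (x i < y j) = (i <= j)%N.
Hypothesis yx : forall i j, (y i < x j) = (i < j)%N.

Lemma interlacing_neq i j : y j != x i.
Proof. by have := xy i j; have := yx j i; case: ltgtP => //= _; lia. Qed.

Lemma interlacing_lt (i k : 'I_m) : (i < k)%N -> x i < x k /\ y i < y k.
Proof.
move=> ik; split.
  by apply: (@lt_trans _ _ (y i)); rewrite ?xy ?yx.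
by apply: (@lt_trans _ _ (x k)); rewrite ?xy ?yx.
Qed.

Lemma interlacing_injl : injective x.
Proof.
move=> i k E; apply/val_inj/eqP; rewrite eqn_leq; apply/andP; split;
  by rewrite leqNgt; apply/negP => /interlacing_lt[]; rewrite E ltxx.
Qed.

Lemma interlacing_injr : injective y.
Proof.
move=> i k E; apply/val_inj/eqP; rewrite eqn_leq; apply/andP; split;
  by rewrite leqNgt; apply/negP => /interlacing_lt[_]; rewrite E ltxx.
Qed.

Let Px' i := \prod_(k < m | k != i) (x i - x k).
Let Py' j := \prod_(k < m | k != j) (y j - y k).
Let Px z := \prod_k (z - x k).
Let Py z := \prod_k (z - y k).

(* [v i ^+ 2] and [w j ^+ 2] are, up to sign, the residues of [Py / Px] at [x i]
   and of [Px / Py] at [y j]; interlacing makes them positive, and then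
   [diag x + v v^T] has the spectrum [y], diagonalized by [cauchy_mx]. *)
Let v i := Num.sqrt (- (Py (x i) / Px' i)).
Let w j := Num.sqrt (Px (y j) / Py' j).

Let x_inj := interlacing_injl.
Let y_inj := interlacing_injr.

Let Px'_neq0 i : Px' i != 0. Proof. exact: lagrange_prod_neq0. Qed.
Let Py'_neq0 i : Py' i != 0. Proof. exact: lagrange_prod_neq0. Qed.
Let yx_neq0 i j : y j - x i != 0. Proof. by rewrite subr_eq0 interlacing_neq. Qed.
Let xy_neq0 i j : x i - y j != 0. Proof. by rewrite subr_eq0 eq_sym interlacing_neq. Qed.
Let Px_neq0 j : Px (y j) != 0. Proof. exact/prodf_neq0. Qed.
Let Py_neq0 i : Py (x i) != 0. Proof. exact/prodf_neq0. Qed.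

Let ratio_gt0 (a b : F) : (a < 0) = (b < 0) -> a != 0 -> b != 0 -> 0 < a / b.
Proof.
move=> ab a0 b0; rewrite lt_neqAle eq_sym mulf_neq0 ?invr_neq0//=.
case: (ltP a 0) (esym ab) => [an bn|ap /negbT].
  by rewrite nmulr_rge0// invr_le0 ltW.
by rewrite -leNgt => bp; rewrite divr_ge0.
Qed.

Let vv_gt0 i : 0 < - (Py (x i) / Px' i).
Proof.
rewrite /Py (bigD1 i)//= -mulrA -mulNr opprB /Px' -prodf_div mulr_gt0//.
  by rewrite subr_gt0 xy.
apply: prodr_gt0 => k ki; apply: ratio_gt0 => //; last first.
  by rewrite subr_eq0 inj_eq// eq_sym.
rewrite !subr_lt0 xy; case: (ltnP i k) => [ik|].
  by rewrite (ltnW ik) (interlacing_lt ik).1.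
rewrite leq_eqVlt val_eqE (negPf ki)/= => lki; rewrite leqNgt lki/=.
by apply/esym/negbTE; rewrite -leNgt ltW// (interlacing_lt lki).1.
Qed.

Let ww_gt0 j : 0 < Px (y j) / Py' j.
Proof.
rewrite /Px (bigD1 j)//= -mulrA /Py' -prodf_div mulr_gt0//.
  by rewrite subr_gt0 xy.
apply: prodr_gt0 => k kj; apply: ratio_gt0 => //; last first.
  by rewrite subr_eq0 inj_eq// eq_sym.
rewrite !subr_lt0 yx; case: (ltnP j k) => [jk|].
  by rewrite (interlacing_lt jk).2.
rewrite leq_eqVlt val_eqE (negPf kj)/= => lkj.
by apply/esym/negbTE; rewrite -leNgt ltW// (interlacing_lt lkj).2.
Qed.

Let v_neq0 i : v i != 0. Proof. by rewrite gt_eqF// sqrtr_gt0. Qed.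
Let vvE i : v i * v i = - (Py (x i) / Px' i).
Proof. by rewrite -expr2 sqr_sqrtr// ltW. Qed.
Let wwE i : w i * w i = Px (y i) / Py' i.
Proof. by rewrite -expr2 sqr_sqrtr// ltW. Qed.

(** Row [j] is the eigenvector [(y_j - diag x)^-1 v] of [diag x + v v^T] at [y j], normalized by
    [w j]. *)
Definition cauchy_mx : 'M[F]_m := \matrix_(j, i) (w j * v i / (y j - x i)).

(** By the choice of [v], the product of rows [j] and [l] is the partial fraction expansion of
    [Q / Px] at [y l], with [Q] the product of the ['X - y k] over [k != j]. It vanishes for
    [l != j], and [w j] normalizes it for [l = j]. *)
Lemma cauchy_mx_orthogonal : cauchy_mx *m cauchy_mx^T = 1%:M.
Proof.
apply/matrixP => j l; rewrite !mxE.
pose Q := \prod_(k < m | k != j) ('X - (y k)%:P) : {poly F}.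
have Qz z : Q.[z] = \prod_(k < m | k != j) (z - y k).
  by rewrite horner_prod_XsubC.
have sQ : (size Q <= m)%N.
  rewrite size_prod => [|k _]; last by rewrite polyXsubC_eq0.
  under eq_bigr do rewrite size_XsubC.
  by have := ltn_ord j; rewrite sum_nat_const cardC1 card_ord; lia.
have := partial_fractions x_inj sQ (fun i => interlacing_neq i l).
rewrite -/(Px (y l)) => QE.
transitivity (w j * w l * (Q.[y l] / Px (y l))).
  rewrite -QE mulr_sumr; apply: eq_bigr => i _; rewrite !mxE -/(Px' i).
  transitivity (w j * w l * (v i * v i / ((y j - x i) * (y l - x i)))).
    by field; rewrite !yx_neq0.
  rewrite vvE; congr (_ * _).
  rewrite Qz /Py (bigD1 j)//=; field.
  by rewrite !yx_neq0 Px'_neq0.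
rewrite Qz; have [<-|jl] := eqVneq j l.
  by rewrite mulr1n wwE -/(Py' j); field; rewrite Py'_neq0 Px_neq0.
have -> : \prod_(k < m | k != j) (y l - y k) = 0.
  by rewrite (bigD1 l) 1?eq_sym//= subrr mul0r.
by rewrite mul0r mulr0.
Qed.

(** Partial fractions over the nodes [y] for [Px - Py], whose leading terms cancel: it equals [Px]
    at each [y j], and its quotient by [Py] at [x i] is -1. *)
Lemma cauchy_mx_weights i : \sum_j w j * cauchy_mx j i = v i.
Proof.
pose p := \prod_k ('X - (x k)%:P) - \prod_k ('X - (y k)%:P) : {poly F}.
have sp : (size p <= m)%N.
  have [->|p0] := eqVneq p 0; first by rewrite size_poly0.
  have m1 : \prod_(k < m) ('X - (x k)%:P) \is monic by exact: monic_prod_XsubC.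
  have m2 : \prod_(k < m) ('X - (y k)%:P) \is monic by exact: monic_prod_XsubC.
  have s1 (z : 'I_m -> F) : size (\prod_(k < m) ('X - (z k)%:P)) = m.+1.
    by rewrite size_prod_XsubC /index_enum -enumT size_enum_ord.
  apply/leq_sizeP => k; rewrite leq_eqVlt => /predU1P[<-|mk].
    rewrite coefB; have := monicP m1; have := monicP m2.
    by rewrite !lead_coefE !s1/= => -> ->; rewrite subrr.
  by rewrite coefB !nth_default ?s1// subrr.
have yi j : x i != y j by rewrite eq_sym interlacing_neq.
have := partial_fractions y_inj sp yi.
have pz z : p.[z] = Px z - Py z.
  by rewrite hornerD hornerN !horner_prod_XsubC.
have Py0 j : Py (y j) = 0 by rewrite /Py (bigD1 j)//= subrr mul0r.
have Px0 j : Px (x j) = 0 by rewrite /Px (bigD1 j)//= subrr mul0r.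
rewrite pz Px0 sub0r mulNr divff// => pE.
transitivity (- v i * -1); last by rewrite mulrN1 opprK.
rewrite -pE mulr_sumr; apply: eq_bigr => j _.
rewrite pz Py0 subr0 mxE -/(Py' j).
transitivity (w j * w j * v i / (y j - x i)); first by field.
by rewrite wwE; field; rewrite yx_neq0 xy_neq0 Py'_neq0.
Qed.

(** The displacement equation of a Cauchy matrix; multiplied by the transpose, and with
    [cauchy_mx_weights], it gives the diagonalization of [diag x + v v^T]. *)
Lemma cauchy_mx_rank1 j i : y j * cauchy_mx j i - cauchy_mx j i * x i = w j * v i.
Proof. by rewrite mxE; field. Qed.

Lemma cauchy_mx_test (b : {poly F}) j : (size b <= m)%N ->
  \sum_i cauchy_mx j i * (b.[x i] / (v i * Px' i)) = w j * (b.[y j] / Px (y j)).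
Proof.
move=> sb; rewrite -(partial_fractions x_inj sb (fun i => interlacing_neq i j)).
rewrite mulr_sumr; apply: eq_bigr => i _; rewrite mxE -/(Px' i); field.
by rewrite v_neq0 yx_neq0 Px'_neq0.
Qed.

(** The test vector [b.[x i] / (v i * Px' i)] is chosen so that [cauchy_mx] maps it to [w j *
    b.[y j] / Px (y j)]. On squaring, [v i ^+ 2] and [w j ^+ 2] turn the coefficients into those of
    the divided difference of [f b^2] over all [2 * m] nodes. *)
Lemma n_monotone_interlacing f (b : {poly F}) : n_monotone m `]0, +oo[ f ->
  (forall i, 0 < x i) -> (forall i, 0 < y i) -> (size b <= m)%N ->
  0 <= \sum_i f (x i) * b.[x i] ^+ 2 / (Px' i * Py (x i)) +
       \sum_j f (y j) * b.[y j] ^+ 2 / (Py' j * Px (y j)).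
Proof.
move=> fm x0 y0 sb; have uU := cauchy_mx_orthogonal; have vu := cauchy_mx_weights.
pose vc : 'cV[F]_m := \col_i v i; pose wc : 'cV[F]_m := \col_i w i.
have E : cauchy_mx^T *m diag_mx (\row_i y i) *m cauchy_mx =
    diag_mx (\row_i x i) + vc *m vc^T.
  have -> : vc = cauchy_mx^T *m wc.
    apply/colP => i; rewrite !mxE -vu; apply: eq_bigr => j _.
    by rewrite !mxE mulrC.
  have {2}-> : cauchy_mx^T *m wc = vc.
    apply/colP => i; rewrite !mxE -vu; apply: eq_bigr => j _.
    by rewrite !mxE mulrC.
  have yu : diag_mx (\row_i y i) *m cauchy_mx =
      cauchy_mx *m diag_mx (\row_i x i) + wc *m vc^T.
    apply/matrixP => j i; rewrite mul_diag_mx mul_mx_diag.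
    have := cauchy_mx_rank1 j i; move: cauchy_mx => U h.
    by rewrite !mxE big_ord1 !mxE -h addrC subrK.
  by rewrite -mulmxA yu mulmxDr !mulmxA (mulmx1C uU) mul1mx.
pose bc : 'cV[F]_m := \col_i (b.[x i] / (v i * Px' i)).
have xp i : 0 < (\row_i x i : 'rV[F]_m) 0 i by rewrite mxE.
have yp i : 0 < (\row_i y i : 'rV[F]_m) 0 i by rewrite mxE.
have := @n_monotone_orthogonal F m f cauchy_mx _ _ vc bc fm uU xp yp E.
rewrite -subr_ge0; congr (0 <= _); rewrite addrC; congr (_ + _).
  rewrite -sumrN; apply: eq_bigr => i _; rewrite !mxE.
  rewrite exprMn exprVn exprMn [v i ^+ 2]vvE; field.
  by rewrite Px'_neq0 Py_neq0.
apply: eq_bigr => j _; have := cauchy_mx_test j sb.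
have -> : \sum_i cauchy_mx j i * (b.[x i] / (v i * Px' i)) = (cauchy_mx *m bc) j 0.
  by rewrite [RHS]mxE; apply: eq_bigr => i _; rewrite [bc _ _]mxE.
move=> ->; rewrite mxE exprMn [w j ^+ 2]wwE; field.
by rewrite Px_neq0 Py'_neq0.
Qed.

End Interlacing.

Lemma big_codom (S T : Type) (idx : T) (op : Monoid.com_law idx) m (x : 'I_m -> S)
    (P : pred S) (g : S -> T) :
  \big[op/idx]_(t <- codom x | P t) g t = \big[op/idx]_(i | P (x i)) g (x i).
Proof. by rewrite /codom big_image_cond. Qed.

(** * Divided differences over unordered nodes *)

Section PickSum.
Variable F : realType.
Implicit Types (l : seq F) (g : F -> F).

(** For a duplicate-free [l] this is the divided difference of [g] at the nodes [l]. *)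
Definition pick_sum l g := \sum_(t <- l) g t / \prod_(u <- l | u != t) (t - u).

Lemma perm_pick_sum l1 l2 g : perm_eq l1 l2 -> pick_sum l1 g = pick_sum l2 g.
Proof.
move=> l12; rewrite /pick_sum (perm_big _ l12)/=; apply: eq_bigr => t _.
by rewrite (perm_big _ l12).
Qed.

Lemma pick_sum_cons t0 l g : t0 \notin l ->
  pick_sum (t0 :: l) g = g t0 / \prod_(u <- l) (t0 - u) +
                         pick_sum l (fun t => g t / (t - t0)).
Proof.
move=> t0l; rewrite /pick_sum big_cons big_cons eqxx/=; congr (_ / _ + _).
  rewrite [LHS]big_mkcond/= !big_seq; apply: eq_bigr => u ul.
  by have -> // : u != t0; apply: contraNneq t0l => <-.
rewrite !big_seq; apply: eq_bigr => t tl; rewrite big_cons.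
have -> : t0 != t by apply: contraNneq t0l => ->.
by rewrite invfM mulrA.
Qed.

(** The entries at even positions become [x] and those at odd positions [y], so comparing values
    amounts to comparing positions. *)
Lemma interlacing_split m l : (size l = (2 * m))%N -> sorted <%R l ->
  exists x y : 'I_m -> F, [/\ forall i j, (x i < y j) = (i <= j)%N,
    forall i j, (y i < x j) = (i < j)%N & perm_eq l (codom x ++ codom y)].
Proof.
move=> sl so; have lt_n i j : (i < (2 * m))%N -> (j < (2 * m))%N ->
    (nth 0 l i < nth 0 l j) = (i < j)%N.
  by move=> im jm; rewrite lt_sorted_ltn_nth ?inE ?sl.
have ul := lt_sorted_uniq so.
exists (fun i => nth 0 l (2 * i)), (fun i => nth 0 l (2 * i).+1); split.
- by move=> i j; rewrite lt_n; move: (ltn_ord i) (ltn_ord j); clear; lia.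
- by move=> i j; rewrite lt_n; move: (ltn_ord i) (ltn_ord j); clear; lia.
apply: uniq_perm => //.
  rewrite cat_uniq; apply/and3P; split.
  - apply/injectiveP => i j /eqP; rewrite nth_uniq ?sl//.
    + by move=> /eqP ij; apply/val_inj => /=; move: ij; clear; lia.
    + by move: (ltn_ord i); clear; lia.
    + by move: (ltn_ord j); clear; lia.
  - apply/hasPn => _ /codomP[i ->]; apply/negP => /codomP[j /eqP].
    by rewrite nth_uniq ?sl//; move: (ltn_ord i) (ltn_ord j); clear; lia.
  - apply/injectiveP => i j /eqP; rewrite nth_uniq ?sl//.
    + by move=> /eqP ij; apply/val_inj => /=; move: ij; clear; lia.
    + by move: (ltn_ord i); clear; lia.
    + by move: (ltn_ord j); clear; lia.
move=> t; rewrite mem_cat; apply/idP/orP => [/(nthP 0)[k + <-]|].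
  rewrite sl => km; case: (boolP (odd k)) => ok; [right|left].
    have km2 : (k./2 < m)%N by move: km; clear; lia.
    by apply/codomP; exists (Ordinal km2) => /=; congr nth; move: ok; clear; lia.
  have km2 : (k./2 < m)%N by move: km; clear; lia.
  by apply/codomP; exists (Ordinal km2) => /=; congr nth; move: ok; clear; lia.
by case=> /codomP[i ->]; apply: mem_nth; rewrite sl; move: (ltn_ord i); clear; lia.
Qed.

Lemma pick_sum_ge0 m l f (b : {poly F}) : n_monotone m `]0, +oo[ f ->
  (size l = (2 * m))%N -> uniq l -> {in l, forall t, 0 < t} -> (size b <= m)%N ->
  0 <= pick_sum l (fun t => f t * b.[t] ^+ 2).
Proof.
move=> fm sl ul l0 sb; set g := fun t => _.
have pl : perm_eq (sort <=%R l) l by rewrite perm_sort.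
have so : sorted <%R (sort <=%R l).
  by rewrite lt_sorted_uniq_le sort_uniq ul sort_le_sorted.
have ss : (size (sort <=%R l) = (2 * m))%N by rewrite size_sort.
have [x [y [xy yx lxy]]] := interlacing_split ss so.
have {}lxy : perm_eq l (codom x ++ codom y) by apply: perm_trans lxy; rewrite perm_sym.
rewrite (perm_pick_sum _ lxy) /pick_sum big_cat/= !big_codom.
have xl i : x i \in l by rewrite (perm_mem lxy) mem_cat codom_f.
have yl i : y i \in l by rewrite (perm_mem lxy) mem_cat codom_f orbT.
have := n_monotone_interlacing xy yx fm (fun i => l0 _ (xl i)) (fun i => l0 _ (yl i)) sb.
congr (0 <= _ + _); apply: eq_bigr => i _; rewrite big_cat/= !big_codom; congr (_ / _).
- congr (_ * _).
    by apply: eq_bigl => k; rewrite inj_eq//; exact: interlacing_injl xy yx.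
  by apply: eq_bigl => k; rewrite interlacing_neq.
- rewrite mulrC; congr (_ * _).
    by apply: eq_bigl => k; rewrite eq_sym interlacing_neq.
  by apply: eq_bigl => k; rewrite inj_eq//; exact: interlacing_injr xy yx.
Qed.

End PickSum.

(** * Positivity on combinations of kernels *)

Section Positivity.
Variables (F : realType) (f : F -> F).
Hypothesis f_gt0 : forall t, 0 < t -> 0 < f t.
Hypothesis f_mono : operator_monotone `]0, +oo[ f.
Implicit Types (l : seq F) (a b p : {poly F}).

Lemma eq_pick_sum l (g h : F -> F) : {in l, g =1 h} -> pick_sum l g = pick_sum l h.
Proof. by move=> gh; apply: eq_big_seq => t tl; rewrite gh. Qed.

Lemma pick_sumZ l (c : F) (g : F -> F) :
  pick_sum l (fun t => c * g t) = c * pick_sum l g.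
Proof. by rewrite mulr_sumr; apply: eq_bigr => t _; rewrite mulrA. Qed.

Lemma pick_sumD l (g h : F -> F) :
  pick_sum l (fun t => g t + h t) = pick_sum l g + pick_sum l h.
Proof. by rewrite -big_split; apply: eq_bigr => t _; rewrite mulrDl. Qed.

Lemma prod_oppB l (P : pred F) z : \prod_(u <- l | P u) (u - z) =
  (-1) ^+ count P l * \prod_(u <- l | P u) (z - u).
Proof.
rewrite -big_filter -[X in _ * X]big_filter -size_filter.
elim: [seq u <- l | P u] => [|u s IH]; first by rewrite !big_nil mulr1.
by rewrite !big_cons IH/= exprS; ring.
Qed.

Lemma count_neq l t : uniq l -> t \in l -> (count (fun u => u != t) l).+1 = size l.
Proof.
move=> ul tl; rewrite -(count_predC (pred1 t) l) /=.
by rewrite count_uniq_mem// tl.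
Qed.

(* Two nodes are added to [l]: the term of [e], below [l], is discarded because
   [0 < f e], and that of [T], above [l], is cancelled by the factor [T - 'X]. *)
Lemma pick_sum_shift_le0 m l a e : size l = (2 * m)%N -> uniq l -> 0 < e ->
  {in l, forall t, e < t} -> (size a <= m)%N ->
  pick_sum l (fun t => f t * a.[t] ^+ 2 / (t - e)) <= 0.
Proof.
move=> sl ul e0 el sa; set S := pick_sum _ _.
pose S' := pick_sum l (fun t => f t * a.[t] ^+ 2 / (t - e) * t).
have H T : e < T -> {in l, forall t, t < T} -> S * T <= S'.
  move=> eT lT; pose b := a * (T%:P - 'X).
  have sb : (size b <= m.+1)%N.
    apply: leq_trans (size_polyMleq _ _) _.
    have -> : size (T%:P - 'X) = 2 by rewrite -opprB size_polyN size_XsubC.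
    by rewrite addn2.
  have enl : e \notin l by apply/negP => /el; rewrite ltxx.
  have Tnl : T \notin e :: l.
    by rewrite inE negb_or gt_eqF//=; apply/negP => /lT; rewrite ltxx.
  have := @pick_sum_ge0 F m.+1 (T :: e :: l) f b (@f_mono m.+1).
  rewrite /= sl Tnl enl ul => /(_ ltac:(lia) isT) H.
  have {H} := H _ sb; rewrite pick_sum_cons// pick_sum_cons//.
  have bE t : b.[t] = a.[t] * (T - t).
    by rewrite /b hornerM hornerD hornerN hornerC hornerX.
  rewrite [b.[T]]bE subrr mulr0 expr0n/= mulr0 mul0r add0r => H.
  have {}H : 0 <= f e * b.[e] ^+ 2 / (e - T) / \prod_(u <- l) (e - u) +
     pick_sum l (fun t => f t * b.[t] ^+ 2 / (t - T) / (t - e)).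
    apply: H => t; rewrite !inE => /or3P[/eqP->|/eqP->|/el] //.
      exact: lt_trans eT.
    exact: lt_trans.
  have le0 : f e * b.[e] ^+ 2 / (e - T) / \prod_(u <- l) (e - u) <= 0.
    (* The number of nodes is even, so the sign changes cancel. *)
    have -> : \prod_(u <- l) (e - u) = \prod_(u <- l) (u - e).
      rewrite prod_oppB count_predT sl exprM.
      by rewrite sqrrN !expr1n mul1r.
    rewrite pmulr_lle0 ?invr_gt0; last first.
      by rewrite big_seq; apply: prodr_gt0 => u /el; rewrite subr_gt0.
    rewrite nmulr_lle0 ?invr_lt0 ?subr_lt0//.
    by rewrite mulr_ge0 ?sqr_ge0// ltW// f_gt0.
  have SE : pick_sum l (fun t => f t * b.[t] ^+ 2 / (t - T) / (t - e)) = S' - T * S.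
    rewrite -pick_sumZ -[- pick_sum _ _]mulN1r -pick_sumZ -pick_sumD.
    apply: eq_pick_sum => t tl; rewrite bE; field.
    by rewrite !subr_eq0 (lt_eqF (lT t tl)) (gt_eqF (el t tl)).
  by move: H le0; rewrite SE; lra.
rewrite leNgt; apply/negP => S0.
(* Beyond [e] and every node, and large enough that [S * T] exceeds [S'] if [S] is positive. *)
pose T := 1 + e + \sum_(t <- l) t + `|S'| / S.
have s0 : 0 <= \sum_(t <- l) t.
  by rewrite big_seq; apply: sumr_ge0 => t /el /(lt_trans e0)/ltW.
have q0 : 0 <= `|S'| / S by rewrite divr_ge0// ltW.
have := H T; rewrite leNgt => /(_ _ _)/negP; apply.
- by rewrite /T; lra.
- move=> t tl; have : t <= \sum_(t <- l) t.
    rewrite (big_rem t)//= lerDl big_seq; apply: sumr_ge0 => u /mem_rem /el.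
    by move=> /(lt_trans e0)/ltW.
  by rewrite /T; lra.
- have : `|S'| / S * S = `|S'| by rewrite divfK// gt_eqF.
  have : 0 < S * (1 + e + \sum_(t <- l) t) by rewrite mulr_gt0//; lra.
  have := ler_norm S'.
  by rewrite /T; move: (`|S'| / S) => q; nra.
Qed.

(** The limit of [pick_sum_shift_le0] as the shift tends to 0. Multiplication by the product of the
    [u - z] makes the sum a polynomial [q] in the shift [z], so [horner_ge0_closure] applies. *)
Lemma pick_sum_div_le0 m l a : size l = (2 * m)%N -> uniq l ->
  {in l, forall t, 0 < t} -> (size a <= m)%N ->
  pick_sum l (fun t => f t / t * a.[t] ^+ 2) <= 0.
Proof.
move=> sl ul l0 sa.
pose c t := f t * a.[t] ^+ 2 / \prod_(u <- l | u != t) (t - u).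
pose q : {poly F} := \sum_(t <- l) c t *: \prod_(u <- l | u != t) (u%:P - 'X).
have qE z : (forall u, u \in l -> z < u) -> q.[z] = \prod_(u <- l) (u - z) *
    pick_sum l (fun t => f t * a.[t] ^+ 2 / (t - z)).
  move=> zl; rewrite horner_sum mulr_sumr; apply: eq_big_seq => t tl.
  rewrite hornerZ horner_prod.
  have -> : \prod_(u <- l | u != t) (u%:P - 'X).[z] = \prod_(u <- l | u != t) (u - z).
    by apply: eq_bigr => u _; rewrite !hornerE.
  rewrite [\prod_(u <- l) (u - z)](bigD1_seq t)//= /c.
  have tz : t - z != 0 by rewrite subr_eq0 gt_eqF// zl.
  by move: (\prod_(u <- l | u != t) (t - u))^-1 => D; field.
have q0 : 0 <= (- q).[0].
  have [d [d0 dl]] : exists d, 0 < d /\ {in l, forall t, d <= t}.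
    elim: l l0 {sl ul c q qE} => [|t l IH] l0; first by exists 1.
    have [|d [d0 dl]] := IH; first by move=> u ul; rewrite l0// inE ul orbT.
    exists (Num.min d t); split; first by rewrite lt_min d0 l0// mem_head.
    by move=> u; rewrite inE ge_min => /predU1P[->|/dl ->//]; rewrite lexx orbT.
  apply: horner_ge0_closure => e e0; pose z := Num.min (d / 2) (e / 2).
  have z0 : 0 < z by rewrite lt_min; lra.
  have zd : z <= d / 2 by rewrite ge_min lexx.
  have ze : z <= e / 2 by rewrite ge_min lexx orbT.
  have zl u : u \in l -> z < u by move=> /dl; lra.
  exists z; first by rewrite subr0 gtr0_norm//; lra.
  rewrite hornerN oppr_ge0 qE// pmulr_rle0; last first.
    by rewrite big_seq; apply: prodr_gt0 => u /zl; rewrite subr_gt0.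
  exact: pick_sum_shift_le0 sl ul z0 zl sa.
move: q0; rewrite hornerN oppr_ge0 qE// pmulr_rle0; last first.
  by rewrite big_seq; apply: prodr_gt0 => u /l0; rewrite subr0.
rewrite (_ : pick_sum _ _ = pick_sum l (fun t => f t / t * a.[t] ^+ 2))//.
by apply: eq_pick_sum => t _; rewrite subr0 mulrAC.
Qed.

(** At [- t] a term [a ^+ 2] remains a square, covered by the inequality for [f t / t]. A term
    ['X * b ^+ 2] acquires the factor [- t], which cancels the denominator and leaves the inequality
    for [f] with opposite sign. *)
Lemma pick_sum_pos_cone m l p : (0 < m)%N -> size l = (2 * m)%N -> uniq l ->
  {in l, forall t, 0 < t} -> pos_cone (2 * m).-1 p ->
  pick_sum l (fun t => f t / t * p.[- t]) <= 0.
Proof.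
move=> m0 sl ul l0.
have flipE (q : {poly F}) (t : F) : q.[- t] = (q \Po (- 'X)).[t] by rewrite horner_comp !hornerE.
have flipS (q : {poly F}) : size (q \Po (- 'X : {poly F})) = size q.
  by rewrite size_comp_poly2// size_polyN size_polyX.
elim=> [|a {}p sa _ IH|b {}p sb _ IH].
- rewrite /pick_sum big1// => t _; by rewrite horner0 mulr0 mul0r.
- rewrite (eq_pick_sum (h := fun t => f t / t * (a \Po - 'X).[t] ^+ 2 + f t / t * p.[- t])).
    rewrite pick_sumD -[leRHS]addr0 lerD//; apply: pick_sum_div_le0 sl ul l0 _.
    by rewrite flipS; move: (size a) sa m0 => k; clear; lia.
  by move=> t _; rewrite -flipE hornerD horner_exp mulrDr.
- rewrite (eq_pick_sum (h := fun t => -1 * (f t * (b \Po - 'X).[t] ^+ 2) + f t / t * p.[- t])).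
    rewrite pick_sumD -[leRHS]addr0 lerD// pick_sumZ mulN1r oppr_le0.
    apply: (pick_sum_ge0 (@f_mono m)) => //.
    by rewrite flipS; move: (size b) sb m0 => k; clear; lia.
  move=> t /l0 t0; rewrite -flipE hornerD hornerM hornerX horner_exp; field.
  by rewrite gt_eqF.
Qed.

(** Clearing denominators and dropping the factor [1 + z] leaves a polynomial [p] nonnegative on the
    half-line. At [- t] only the term of [t] survives in [p]; its product differs from the
    denominator in [pick_sum] by an odd number of signs, so [pick_sum_pos_cone] is the claim
    negated. *)
Lemma kernel_positivity_uniq m l (c : F -> F) : size l = (2 * m)%N -> uniq l ->
  {in l, forall t, 0 < t} ->
  (forall z, 0 <= z -> 0 <= \sum_(t <- l) c t * (t * (1 + z) / (t + z))) ->
  0 <= \sum_(t <- l) c t * f t.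
Proof.
case: m => [|m] sl ul l0 H.
  by rewrite (size0nil sl) big_nil.
pose p : {poly F} := \sum_(t <- l) (c t * t) *: \prod_(u <- l | u != t) ('X - (- u)%:P).
have pE z : p.[z] = \sum_(t <- l) c t * t * \prod_(u <- l | u != t) (u + z).
  rewrite horner_sum; apply: eq_bigr => t _; rewrite hornerZ horner_prod.
  by congr (_ * _); apply: eq_bigr => u _; rewrite !hornerE opprK addrC.
have p0 z : 0 <= z -> 0 <= p.[z].
  move=> z0; have := H z z0; have z1 : 0 < 1 + z by lra.
  have pr0 : 0 < \prod_(u <- l) (u + z).
    by rewrite big_seq; apply: prodr_gt0 => u /l0; lra.
  rewrite -(pmulr_rge0 _ pr0) -(pmulr_rge0 p.[z] z1); congr (0 <= _).
  rewrite pE !mulr_sumr; apply: eq_big_seq => t tl.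
  rewrite [\prod_(u <- l) (u + z)](bigD1_seq t)//=; field.
  by rewrite gt_eqF//; have := l0 t tl; lra.
have sp : (size p <= 2 * m.+1)%N.
  apply: leq_trans (size_sum _ _ _) _; apply/bigmax_leqP_seq => t tl _.
  apply: leq_trans (size_scale_leq _ _) _.
  by rewrite -big_filter size_prod_XsubC size_filter count_neq// sl.
have pc : pos_cone (2 * m.+1).-1 p 
  by apply: pos_cone_leq (pos_coneP p0); move: (size p) sp => k; clear; lia.
have := pick_sum_pos_cone (ltn0Sn m) sl ul l0 pc; rewrite -oppr_ge0; congr (0 <= _).
rewrite /pick_sum -sumrN; apply: eq_big_seq => t tl.
have t0 := l0 t tl.
have pr0 : \prod_(u <- l | u != t) (t - u) != 0.
  by rewrite prodf_seq_neq0; apply/allP => u _; apply/implyP => ut; rewrite subr_eq0 eq_sym.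
have -> : p.[- t] = c t * t * \prod_(u <- l | u != t) (u - t).
  rewrite pE (bigD1_seq t)//= [X in _ + X]big1_seq ?addr0// => u /andP[ut _].
  have -> : \prod_(v <- l | v != u) (v - t) = 0.
    rewrite -big_filter (bigD1_seq t) ?filter_uniq//= ?subrr ?mul0r//.
    by rewrite mem_filter eq_sym ut.
  by rewrite mulr0.
rewrite prod_oppB -signr_odd.
have -> : odd (count (fun u => u != t) l).
  by have := count_neq ul tl; rewrite sl; lia.
by rewrite expr1; field; rewrite pr0 gt_eqF.
Qed.

Lemma kernel_positivity (s : seq (F * F)) : {in s, forall x, 0 < x.2} ->
  (forall z, 0 <= z -> 0 <= \sum_(x <- s) x.1 * (x.2 * (1 + z) / (x.2 + z))) ->
  0 <= \sum_(x <- s) x.1 * f x.2.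
Proof.
move=> s0 H.
have [m [l [sl ul l0 sub]]] : exists m l, [/\ size l = (2 * m)%N, uniq l,
    {in l, forall t, 0 < t} & {subset map snd s <= l}].
  pose l := undup (map snd s).
  have l0 : {in l, forall t, 0 < t}.
    by move=> t; rewrite mem_undup => /mapP[x /s0 x0 ->].
  case: (boolP (odd (size l))) => ol; last first.
    exists (size l)./2, l; split => //; first by move: (size l) ol => k; clear; lia.
      exact: undup_uniq.
    by move=> t; rewrite mem_undup.
  (* An extra node makes the number of nodes even. It exceeds all the others, so its coefficient
     [c t0] will be an empty sum. *)
  pose t0 := 1 + \sum_(t <- l) t.
  have sum0 : 0 <= \sum_(t <- l) t by rewrite big_seq; apply: sumr_ge0 => t /l0/ltW.
  exists (size l).+1./2, (t0 :: l); split => /=; first by move: (size l) ol => k; clear; lia.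
  - rewrite undup_uniq andbT; apply/negP => tl.
    have := sum0; have : t0 <= \sum_(t <- l) t; last by rewrite /t0; lra.
    rewrite (big_rem t0)//= lerDl big_seq; apply: sumr_ge0 => u /mem_rem /l0.
    by move=> /ltW.
  - by move=> t; rewrite inE => /predU1P[->|/l0//]; rewrite /t0; lra.
  - by move=> t ts; rewrite inE mem_undup ts orbT.
pose c t := \sum_(x <- s | x.2 == t) x.1.
have cE (g : F -> F) : \sum_(x <- s) x.1 * g x.2 = \sum_(t <- l) c t * g t.
  under [RHS]eq_bigr do rewrite mulr_suml big_mkcond/=.
  rewrite exchange_big/=; apply: eq_big_seq => x xs.
  rewrite (bigD1_seq x.2)//=; last by apply: sub; exact: map_f.
  rewrite eqxx big1_seq ?addr0// => t /andP[tx _].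
  by rewrite eq_sym (negPf tx).
rewrite cE; apply: kernel_positivity_uniq sl ul l0 _ => z z0.
by rewrite -(cE (fun t => t * (1 + z) / (t + z))); exact: H.
Qed.

End Positivity.

(** * Hahn-Banach extension *)

Section Sublinear.
Context {R : realType} {V : lmodType R}.
Implicit Types (p q : V -> R) (u v : V) (a : R).

Definition sublinear p := (forall u v, p (u + v) <= p u + p v) /\
  (forall a v, 0 < a -> p (a *: v) <= a * p v).

Lemma sublinear_homo p a v : sublinear p -> 0 < a -> p (a *: v) = a * p v.
Proof.
move=> [_ ph] a0; apply/eqP; rewrite eq_le ph//=.
have := ph a^-1 (a *: v); rewrite scalerA mulVf ?gt_eqF// scale1r invr_gt0.
by move=> /(_ a0); rewrite ler_pdivlMl.
Qed.

Lemma sublinear0 p : sublinear p -> p 0 = 0.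
Proof.
by move=> sp; have := sublinear_homo 0 sp (@ltr0Sn R 1); rewrite scaler0; lra.
Qed.

Lemma sublinear_opp p v : sublinear p -> - p (- v) <= p v.
Proof.
by move=> sp; have := sp.1 v (- v); rewrite subrr sublinear0//; lra.
Qed.

(** For subadditivity, near-optimal functions for [u] and for [v] are replaced by a common minorant
    in [A]; the bound [b] keeps the infima finite. *)
Lemma sublinear_inf (A : set (V -> R)) (b : V -> R) : A !=set0 ->
  (forall q, A q -> sublinear q) -> (forall q v, A q -> b v <= q v) ->
  (forall q1 q2, A q1 -> A q2 ->
    exists2 q, A q & forall v, q v <= q1 v /\ q v <= q2 v) ->
  sublinear (fun v => inf [set q v | q in A]).
Proof.
move=> [q0 Aq0] Asub Ab Adir.
have infA q v : A q -> inf [set q v | q in A] <= q v.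
  move=> Aq; apply: ge_inf; last by exists q.
  by exists (b v) => _ [q' Aq' <-]; exact: Ab.
split=> [u v|a v a0].
  rewrite -lerBlDl; apply: lb_le_inf; first by exists (q0 v), q0.
  move=> _ [q2 Aq2 <-]; rewrite lerBlDl -lerBlDr; apply: lb_le_inf.
    by exists (q0 u), q0.
  move=> _ [q1 Aq1 <-]; rewrite lerBlDr; have [q Aq qle] := Adir _ _ Aq1 Aq2.
  apply: le_trans (infA q _ Aq) _; apply: le_trans ((Asub _ Aq).1 _ _) _.
  by apply: lerD; [exact: (qle u).1|exact: (qle v).2].
rewrite -ler_pdivrMl//; apply: lb_le_inf; first by exists (q0 v), q0.
move=> _ [q Aq <-]; rewrite ler_pdivrMl//; apply: le_trans (infA q _ Aq) _.
exact: (Asub _ Aq).2.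
Qed.

Lemma minimal_sublinear p : sublinear p -> exists q, [/\ sublinear q,
  forall v, q v <= p v &
  forall r, sublinear r -> (forall v, r v <= q v) -> r = q].
Proof.
move=> sp; pose T := {q : V -> R | `[< sublinear q /\ forall v, q v <= p v >]}.
(* The order is reversed, so that a maximal element for Zorn's lemma is a minimal sublinear
   function. *)
pose le_sub (q1 q2 : T) := `[< forall v, sval q2 v <= sval q1 v >].
have TP (q : T) : sublinear (sval q) /\ forall v, sval q v <= p v.
  by have /asboolP := svalP q.
pose mkT (q : V -> R) (qP : `[< sublinear q /\ forall v, q v <= p v >]) : T :=
    exist (fun q : V -> R => is_true `[< sublinear q /\ forall v, q v <= p v >]) q qP.
have [||||m mP] := @Zorn T le_sub.
- by move=> t; apply/asboolP.
- move=> r s t /asboolP rs /asboolP st; apply/asboolP => v.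
  exact: le_trans (st v) (rs v).
- move=> s t /asboolP st /asboolP ts; apply/val_inj/funext => v.
  by apply/eqP; rewrite eq_le; apply/andP; split; [exact: ts|exact: st].
- move=> A Atot; have [[t0 At0]|A0] := pselect (A !=set0); last first.
    have pP : `[< sublinear p /\ forall v, p v <= p v >] by apply/asboolP.
    by exists (mkT p pP) => s As; case: A0; exists s.
  pose A' := [set sval t | t in A].
  have A'0 : A' !=set0 by exists (sval t0), t0.
  have lbA' (q : V -> R) v : A' q -> - p (- v) <= q v.
    move=> [t At <-]; apply: le_trans (sublinear_opp v (TP t).1).
    by rewrite lerN2; exact: (TP t).2.
  have infA' (t : T) v : A t -> inf [set q v | q in A'] <= sval t v.
    move=> At; apply: ge_inf; last by exists (sval t) => //; exists t.
    by exists (- p (- v)) => _ [q' Aq' <-]; exact: lbA'.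
  have mP : `[< sublinear (fun v => inf [set q v | q in A']) /\
      forall v, inf [set q v | q in A'] <= p v >].
    apply/asboolP; split; last first.
      by move=> v; apply: le_trans (infA' t0 v At0) _; exact: (TP t0).2.
    apply: (sublinear_inf A'0 _ lbA') => [q [t _ <-]|q1 q2 [t1 At1 <-] [t2 At2 <-]].
      exact: (TP t).1.
    have [/asboolP h|/asboolP h] := Atot _ _ At1 At2.
      by exists (sval t2); [exists t2|move=> v; split].
    by exists (sval t1); [exists t1|move=> v; split].
  by exists (mkT _ mP) => s As; apply/asboolP => v /=; exact: infA'.
exists (sval m); have [sm mp] := TP m; split => // r sr rm.
have rP : `[< sublinear r /\ forall v, r v <= p v >].
  by apply/asboolP; split => // v; exact: le_trans (mp v).
have := mP (mkT r rP); move=> /(_ ltac:(by apply/asboolP)).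
by move=> /(congr1 sval).
Qed.

(** A minimal sublinear [q] below [p] is linear: superadditivity comes from minimality, and with
    subadditivity it gives additivity. *)
Lemma sublinear_dominates p : sublinear p -> exists L : V -> R,
  [/\ forall v, L v <= p v, forall u v, L (u + v) = L u + L v &
      forall a v, L (a *: v) = a * L v].
Proof.
move=> /minimal_sublinear[q [sq qp qmin]].
have shift v0 v s : 0 <= s -> s * q v0 - q (- v) <= q (v + s *: v0).
  rewrite le_eqVlt => /predU1P[<-|s0].
    by rewrite mul0r scale0r addr0 sub0r sublinear_opp.
  have := sq.1 (v + s *: v0) (- v).
  by rewrite addrAC subrr add0r sublinear_homo//; lra.
have super v0 v : q v + q v0 <= q (v + v0).
  (* This function is sublinear and at most [q] (take [s = 0]), hence equal to [q]; then [s = 1] is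
     superadditivity. [shift] bounds the set from below. *)
  pose r v := inf [set q (v + s *: v0) - s * q v0 | s in [set s | 0 <= s]].
  have rle s u : 0 <= s -> r u <= q (u + s *: v0) - s * q v0.
    move=> s0; apply: ge_inf; last by exists s.
    by exists (- q (- u)) => _ [s' s'0 <-]; have := shift v0 u s' s'0; lra.
  have le_r c u : (forall s, 0 <= s -> c <= q (u + s *: v0) - s * q v0) -> c <= r u.
    move=> H; apply: lb_le_inf; first by exists (q (u + 0 *: v0) - 0 * q v0), 0 => //=.
    by move=> _ [s s0 <-]; exact: H.
  have sr : sublinear r.
    split=> [u w|a u a0].
      rewrite -lerBlDl; apply: (le_r _ _) => s2 s20; rewrite lerBlDl -lerBlDr.
      apply: (le_r _ _) => s1 s10; rewrite lerBlDr.
      apply: le_trans (rle (s1 + s2) _ (addr_ge0 s10 s20)) _.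
      have := sq.1 (u + s1 *: v0) (w + s2 *: v0).
      by rewrite addrACA -scalerDl; lra.
    rewrite -ler_pdivrMl//; apply: (le_r _ _) => s s0; rewrite ler_pdivrMl//.
    apply: le_trans (rle (a * s) _ (mulr_ge0 (ltW a0) s0)) _.
    by rewrite -scalerA -scalerDr sublinear_homo// mulrBr mulrA.
  have rq u : r u <= q u.
    by have := rle 0 u (lexx _); rewrite scale0r addr0 mul0r subr0.
  have <- : r = q by exact: qmin.
  have := rle 1 v ler01; rewrite scale1r mul1r.
  by have -> : r = q; [exact: qmin|lra].
have qD u v : q (u + v) = q u + q v by apply/eqP; rewrite eq_le super sq.1.
have qN v : q (- v) = - q v.
  by have := qD v (- v); rewrite subrr sublinear0//; lra.
exists q; split => // a v; have [a0|a0|->] := ltgtP a 0.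
- have := sublinear_homo v sq (_ : 0 < - a); rewrite oppr_gt0 => /(_ a0).
  by rewrite scaleNr qN mulNr => /oppr_inj.
- exact: sublinear_homo.
- by rewrite scale0r mul0r sublinear0.
Qed.

End Sublinear.

(** * The vector space of bounded functions *)

Section BndFun.
Context {R : realType}.

Definition bounded_pred : {pred R -> R} :=
  fun g => `[< exists M, forall s, `|g s| <= M >].

Lemma bounded_pred_submod : submod_closed bounded_pred.
Proof.
split=> [|a g h /asboolP[M gM] /asboolP[N hN]]; apply/asboolP.
  by exists 0 => s; rewrite normr0.
exists (`|a| * M + N) => s; apply: le_trans (ler_normD _ _) _.
by rewrite lerD// normrM ler_wpM2l.
Qed.

HB.instance Definition _ :=
  GRing.isSubmodClosed.Build R (R -> R) bounded_pred bounded_pred_submod.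

Record bnd_fun := BndFun {
  bnd_fun_val : R -> R; _ : bnd_fun_val \in bounded_pred }.

HB.instance Definition _ := [isSub for bnd_fun_val].
HB.instance Definition _ := [Choice of bnd_fun by <:].
HB.instance Definition _ := [SubChoice_isSubLmodule of bnd_fun by <:].

End BndFun.

(** * The dominated functional and its values on indicators *)

Section DistributionFunction.
Variables (R : realType) (f : R -> R).
Hypothesis f_gt0 : forall t, 0 < t -> 0 < f t.
Hypothesis f_mono : operator_monotone `]0, +oo[ f.

(* The kernel in the coordinate [u = 1 / (1 + lambda)], so that [u = 0] is
   [lambda = +oo]. *)
Definition kernel01 (t u : R) : R := t / (1 + (t - 1) * u).

Lemma kernel01_den_gt0 (t u : R) : 0 < t -> 0 <= u <= 1 -> 0 < 1 + (t - 1) * u.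
Proof. by move=> t0 /andP[u0 u1]; nra. Qed.

Lemma kernel01_1 (u : R) : kernel01 1 u = 1.
Proof. by rewrite /kernel01 subrr mul0r addr0 divr1. Qed.

Lemma kernel01_positivity (s : seq (R * R)) : {in s, forall x, 0 < x.2} ->
  (forall u, 0 <= u <= 1 -> 0 <= \sum_(x <- s) x.1 * kernel01 x.2 u) ->
  0 <= \sum_(x <- s) x.1 * f x.2.
Proof.
move=> s0 H; apply: kernel_positivity => // z z0.
have z1 : 0 < 1 + z by lra.
have := H (1 + z)^-1; rewrite invr_ge0 (ltW z1) invf_le1//.
have -> : (1 <= 1 + z) = true by lra.
move=> /(_ isT); congr (0 <= _); apply: eq_big_seq => x /s0 x0.
rewrite /kernel01; congr (_ * _); field.
by rewrite !gt_eqF//=; lra.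
Qed.

Let combos (v : R -> R) := [set s : seq (R * R) | {in s, forall x, 0 < x.2} /\
  forall u, 0 <= u <= 1 -> v u <= \sum_(x <- s) x.1 * kernel01 x.2 u].
Let cost (s : seq (R * R)) := \sum_(x <- s) x.1 * f x.2.
(* The Hahn-Banach majorant: the best upper estimate of [v] by kernels. *)
Let upper (v : @bnd_fun R) := inf [set cost s | s in combos (val v)].

Let combos_neq0 (v : @bnd_fun R) : exists2 M, 0 <= M & combos (val v) [:: (M, 1)].
Proof.
have /asboolP[M vM] := valP v; have M0 : 0 <= M.
  by apply: le_trans (vM 0).
exists M => //; split; first by move=> x; rewrite inE => /eqP->/=.
move=> u _; rewrite big_seq1/= kernel01_1 mulr1; apply: le_trans (vM u).
exact: ler_norm.
Qed.

Let upper_le (v : @bnd_fun R) s : combos (val v) s -> upper v <= cost s.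
Proof.
move=> vs; apply: ge_inf; last by exists s.
have [M M0 [_ vM]] := combos_neq0 (- v).
(* A constant kernel dominating [- v], added to any majorant of [v], gives a nonnegative
   combination. Positivity thus bounds all costs from below, and the infimum is a genuine one. *)
exists (- (M * f 1)) => _ [s' [s'0 vs'] <-].
rewrite -subr_ge0 opprK.
have := @kernel01_positivity ((M, 1) :: s').
rewrite big_cons/= -/(cost s') addrC; apply.
  by move=> x; rewrite inE => /predU1P[->//|/s'0].
move=> u u01; rewrite big_cons/=.
have : - val v u <= _ := vM u u01; have := vs' u u01.
by rewrite big_seq1/=; lra.
Qed.

Let upper_sublinear : sublinear upper.
Proof.
have le_upper c (v : @bnd_fun R) :
    (forall s, combos (val v) s -> c <= cost s) -> c <= upper v.
  move=> H; apply: lb_le_inf; last by move=> _ [s vs <-]; exact: H.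
  by have [M _ vM] := combos_neq0 v; exists (cost [:: (M, 1)]), [:: (M, 1)].
split=> [u v|a v a0].
  rewrite -lerBlDl; apply: (le_upper) => s2 [s20 h2]; rewrite lerBlDl -lerBlDr.
  apply: (le_upper) => s1 [s10 h1]; rewrite lerBlDr /cost -big_cat.
  apply: upper_le; split.
    by move=> x; rewrite mem_cat => /orP[/s10|/s20].
  by move=> z z01; rewrite big_cat/=; apply: lerD; [exact: h1|exact: h2].
rewrite -ler_pdivrMl//; apply: (le_upper) => s [s0 h]; rewrite ler_pdivrMl//.
rewrite /cost mulr_sumr.
have -> : \sum_(x <- s) a * (x.1 * f x.2) = cost [seq (a * x.1, x.2) | x <- s].
  by rewrite /cost big_map; apply: eq_bigr => x _ /=; rewrite mulrA.
apply: upper_le; split; first by move=> _ /mapP[x /s0 x0 ->].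
move=> z z01; rewrite big_map/=.
under eq_bigr do rewrite -mulrA.
by rewrite -mulr_sumr; apply: ler_wpM2l; [exact: ltW|exact: h].
Qed.

(** [G x] is the value of the extended functional at the indicator of [u <= x]. Coefficients of
    either sign are allowed, so estimates from above and from below both transfer from [[0, 1]] to
    [G] and [f]. *)
Lemma distribution_function : exists G : R -> R, forall r s : seq (R * R),
  {in s, forall x, 0 < x.2} ->
  (forall u : R, 0 <= u <= 1 -> \sum_(y <- r) y.1 * (u <= y.2)%R%:R <=
     \sum_(x <- s) x.1 * kernel01 x.2 u) ->
  \sum_(y <- r) y.1 * G y.2 <= \sum_(x <- s) x.1 * f x.2.
Proof.
have [L [Lle LD LZ]] := sublinear_dominates upper_sublinear.
have ind_bounded (x : R) : (fun u : R => (u <= x)%R%:R : R) \in bounded_pred.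
  by apply/asboolP; exists 1 => u; rewrite ger0_norm// lern1 leq_b1.
pose ind x := BndFun (ind_bounded x).
have L0 : L 0 = 0 by have := LZ 0 0; rewrite scale0r mul0r.
exists (fun x => L (ind x)) => r s s0 H.
pose v := \sum_(y <- r) y.1 *: ind y.2.
have -> : \sum_(y <- r) y.1 * L (ind y.2) = L v.
  rewrite /v; elim: r {H v} => [|y r IH]; first by rewrite !big_nil L0.
  by rewrite !big_cons LD LZ IH.
apply: le_trans (Lle v) _; apply: upper_le; split => // u u01.
have -> : val v u = \sum_(y <- r) y.1 * (u <= y.2)%R%:R.
  rewrite /v; elim: r {H v} => [|y r IH]; first by rewrite !big_nil.
  by rewrite !big_cons -IH.
exact: H.
Qed.

End DistributionFunction.

(** * The representing measure *)

Section StepApproximation.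
Variable R : realType.

(** The differences are indicators of the half-open cells; [v] lies in exactly one of them, which
    selects one [c i]. *)
Lemma step_approximation (n : nat) (w c : nat -> R) (v h d : R) :
  {homo w : i j / (i <= j)%N >-> i <= j} -> w 0 < v <= w n ->
  (forall i, (i < n)%N -> w i < v <= w i.+1 -> `|h - c i| <= d) ->
  `|\sum_(i < n) c i * ((v <= w i.+1)%R%:R - (v <= w i)%R%:R) - h| <= d.
Proof.
move=> wnd /andP[w0 wn] hc.
pose D i : R := (v <= w i.+1)%R%:R - (v <= w i)%R%:R.
have DE i : D i = (w i < v <= w i.+1)%R%:R.
  rewrite /D ltNge; case: (boolP (v <= w i)) => /= vw; last by rewrite subr0.
  by rewrite (le_trans vw) ?subrr// wnd.
have D1 : \sum_(i < n) D i = 1.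
  rewrite -(big_mkord xpredT D) telescope_sumr// wn.
  by rewrite leNgt w0 subr0.
have -> : \sum_(i < n) c i * D i - h = \sum_(i < n) (c i - h) * D i.
  under [RHS]eq_bigr do rewrite mulrBl.
  by rewrite sumrB -mulr_sumr D1 mulr1.
apply: le_trans (ler_norm_sum _ _ _) _.
rewrite -[d]mulr1 -D1 mulr_sumr; apply: ler_sum => i _.
rewrite normrM DE; case: (boolP (w i < v <= w i.+1)) => wi; last first.
  by rewrite normr0 !mulr0.
by rewrite normr1 !mulr1 distrC hc.
Qed.

Lemma nonincreasing_emeasurable (f : R -> \bar R) :
  {homo f : x y / (x <= y)%R >-> (y <= x)%E} -> measurable_fun setT f.
Proof.
move=> f_ni; apply: (measurability (@ErealGenCInfty.G R)) => [|/= _ [_] [r] -> <-].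
  exact: ErealGenCInfty.measurableE.
apply: measurableI => //; apply: is_interval_measurable => s t/=.
rewrite !in_itv/= !andbT => fs ft u /andP[su ut].
by rewrite in_itv/= andbT (le_trans ft)// f_ni.
Qed.

Lemma kernel_fun_bounds (t : R) (l : \bar R) : 0 < t -> ext_halfline l ->
  0 <= kernel_fun t l <= 1 + t.
Proof.
move=> t0; case: l => [r| |]; rewrite /ext_halfline/= in_itv/= ?lee_fin//.
  rewrite leey andbT => r0; have tr0 : 0 < t + r by exact: ltr_wpDr.
  apply/andP; split; last by rewrite ler_pdivrMr//; nra.
  by rewrite divr_ge0 ?mulr_ge0 ?addr_ge0// ltW.
by move=> _; rewrite (ltW t0)/= lerDr.
Qed.

Lemma kernel_fun_measurable (t : R) : 0 < t ->
  measurable_fun (@ext_halfline R) (fun l => (kernel_fun t l)%:E).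
Proof.
move=> t0; apply/measurable_EFinP.
have -> : @ext_halfline R = [set` `[0%E, +oo%E[ ] `|` [set +oo%E].
  apply/seteqP; split => [[r| |]|[r| |] []]; rewrite /ext_halfline/= ?in_itv/= ?ltry ?leey ?ltxx ?andbT ?andbF//.
  - by left.
  - by right.
apply/measurable_funU; [exact: emeasurable_itv|exact: emeasurable_set1|split].
  (* The kernel rewritten with a single occurrence of [r]; the truncation at 0 makes the inverse
     nonincreasing on the whole line. *)
  pose g (r : R) := t + t * (1 - t) * (t + Num.max r 0)^-1.
  apply: (eq_measurable_fun (g \o fine)).
    move=> [r| |]; rewrite inE/= in_itv/= ?lee_fin ?ltry ?andbT// ?ltxx ?andbF// => r0.
    rewrite /g (max_idPl r0); field.
    by rewrite gt_eqF//; lra.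
  apply: measurableT_comp; last exact: fine_measurable (emeasurable_itv _).
  apply: measurable_funD; first exact: measurable_cst.
  apply: measurable_funM; first exact: measurable_cst.
  apply: nonincreasing_measurable => // r s rs.
  rewrite lef_pV2 ?posrE; try by apply: ltr_wpDr => //; rewrite le_max lexx orbT.
  by rewrite lerD2l ge_max !le_max rs lexx !orbT.
exact: measurable_fun_set1.
Qed.

End StepApproximation.

Section FinitePushforward.
Context d1 d2 (T1 : measurableType d1) (T2 : measurableType d2) (R : realType).
Variables (nu : {finite_measure set T1 -> \bar R}) (g : T1 -> T2).

Definition fin_pushforward (mg : measurable_fun setT g) : set T2 -> \bar R :=
  pushforward nu g.

Hypothesis mg : measurable_fun setT g.

HB.instance Definition _ := Measure.copy (fin_pushforward mg)
  (measure_function_pushforward__canonical__measure_function_Measure nu mg).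

Let fin_pushforward_fin : fin_num_fun (fin_pushforward mg).
Proof.
move=> A mA; apply: fin_num_measure.
by rewrite -[X in measurable X]setTI; exact: mg.
Qed.

HB.instance Definition _ :=
  Measure_isFinite.Build _ _ _ (fin_pushforward mg) fin_pushforward_fin.

End FinitePushforward.

(** * The law of the quantile function *)

Section RepresentingMeasure.
Variables (R : realType) (f G : R -> R).
Hypothesis f_gt0 : forall t, 0 < t -> 0 < f t.
Hypothesis GP : forall r s : seq (R * R), {in s, forall x, 0 < x.2} ->
  (forall u : R, 0 <= u <= 1 -> \sum_(y <- r) y.1 * (u <= y.2)%R%:R <=
     \sum_(x <- s) x.1 * kernel01 x.2 u) ->
  \sum_(y <- r) y.1 * G y.2 <= \sum_(x <- s) x.1 * f x.2.

Let M := f 1.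

Let G_nd : {homo G : x y / x <= y}.
Proof.
move=> x y xy; have := GP (r := [:: (1, x); (-1, y)]) (s := [::]).
rewrite !big_cons !big_nil/= => /(_ ltac:(by [])) H.
suff : 1 * G x + (-1 * G y + 0) <= 0 by lra.
apply: H => u _; rewrite !big_cons !big_nil/=.
case: (leP u x) => ux; last by rewrite mulr0 addr0 add0r mulN1r oppr_le0.
by rewrite (le_trans ux xy); lra.
Qed.

Let G_lt0 x : x < 0 -> G x = 0.
Proof.
move=> x0; have ux u : 0 <= u -> (u <= x) = false.
  by move=> u0; apply/negbTE; rewrite -ltNge (lt_le_trans x0 u0).
 apply/eqP; rewrite eq_le; apply/andP; split.
  have := GP (r := [:: (1, x)]) (s := [::]).
  rewrite !big_cons !big_nil/= mul1r addr0; apply => // u /andP[u0 _].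
  by rewrite !big_cons !big_nil/= ux// mulr0 addr0.
have := GP (r := [:: (-1, x)]) (s := [::]).
rewrite !big_cons !big_nil/= mulN1r addr0 oppr_le0; apply => // u /andP[u0 _].
by rewrite !big_cons !big_nil/= ux// mulr0 addr0.
Qed.

(** On [[0, 1]] the indicator is then the constant kernel [kernel01 1], and [GP] is used with both
    signs. *)
Let G_ge1 x : 1 <= x -> G x = M.
Proof.
have pos1 (c : R) : {in [:: (c, 1 : R)], forall x, 0 < x.2}.
  by move=> y; rewrite inE => /eqP->.
move=> x1; apply/eqP; rewrite eq_le; apply/andP; split.
  have := GP (r := [:: (1, x)]) (pos1 1).
  rewrite !big_cons !big_nil/= !mul1r !addr0; apply => u /andP[_ u1].
  by rewrite !big_cons !big_nil/= kernel01_1 (le_trans u1 x1).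
have := GP (r := [:: (-1, x)]) (pos1 (-1)).
rewrite !big_cons !big_nil/= !mulN1r !addr0 lerN2; apply => u /andP[_ u1].
by rewrite !big_cons !big_nil/= kernel01_1 (le_trans u1 x1).
Qed.

Let G_ge0 x : 0 <= G x.
Proof.
case: (ltP x 0) => [x0|x0]; first by rewrite G_lt0.
by rewrite -(G_lt0 (ltrN10 R)) G_nd//; lra.
Qed.

Let G_leM x : G x <= M.
Proof.
have /orP[x1|x1] := le_total x 1; last by rewrite G_ge1.
by rewrite -(G_ge1 (lexx 1)) G_nd.
Qed.

(** On [[0, 1]] the step function with values [c i] differs from the kernel of [t] by at most [d]
    times the constant kernel, whose cost is [M]; [GP] carries this over to [G] and [f]. *)
Lemma distribution_riemann_sum n (z c : nat -> R) t d : 0 < t ->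
  {homo z : i j / (i <= j)%N >-> i <= j} -> z 0 < 0 -> 1 <= z n ->
  (forall i u, (i < n)%N -> 0 <= u <= 1 -> z i < u <= z i.+1 ->
     `|kernel01 t u - c i| <= d) ->
  `|\sum_(i < n) c i * (G (z i.+1) - G (z i)) - f t| <= d * M.
Proof.
move=> t0 znd z0 zn H.
(* The step function as a combination of indicators, scaled by [a]; [a = -1] and [a = 1] give the
   two one-sided estimates. *)
pose r (a : R) := [seq (a * c i, z i.+1) | i <- iota 0 n] ++
  [seq (- (a * c i), z i) | i <- iota 0 n].
have rE a (g : R -> R) : \sum_(y <- r a) y.1 * g y.2 =
    a * \sum_(i < n) c i * (g (z i.+1) - g (z i)).
  rewrite big_cat !big_map/= -{1 2}[n]subn0 -/(index_iota 0 n) -big_split/=.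
  rewrite big_mkord mulr_sumr; apply: eq_bigr => i _.
  by rewrite mulNr -mulrBr mulrA.
have sP a b : {in [:: (a, t); (b, 1)], forall x : R * R, 0 < x.2}.
  by move=> x; rewrite !inE => /orP[]/eqP->.
have cell u : 0 <= u <= 1 ->
    `|\sum_(i < n) c i * ((u <= z i.+1)%R%:R - (u <= z i)%R%:R) - kernel01 t u| <= d.
  move=> u01; apply: step_approximation => // [|i iN iu].
    by case/andP: u01 => u0 u1; rewrite (lt_le_trans z0 u0) (le_trans u1 zn).
  exact: H.
rewrite ler_norml; apply/andP; split.
  have := GP (r := r (-1)) (sP (-1) d); rewrite rE !big_cons !big_nil/=.
  rewrite -/M => h; rewrite lerBrDl; suff : -1 * \sum_(i < n) c i * (G (z i.+1) - G (z i)) <=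
     -1 * f t + (d * M + 0) by lra.
  apply: h => u u01; rewrite (rE _ (fun x => (u <= x)%R%:R)) !big_cons !big_nil/= kernel01_1.
  by have := cell u u01; rewrite ler_norml => /andP[]; lra.
have := GP (r := r 1) (sP 1 d); rewrite rE !big_cons !big_nil/=.
rewrite -/M => h; suff : 1 * \sum_(i < n) c i * (G (z i.+1) - G (z i)) <=
     1 * f t + (d * M + 0) by lra.
apply: h => u u01; rewrite (rE _ (fun x => (u <= x)%R%:R)) !big_cons !big_nil/= kernel01_1.
by have := cell u u01; rewrite ler_norml => /andP[]; lra.
Qed.

(* The quantile function of [G]; truncating [v] at [M] keeps the set nonempty. *)
Let Q v := inf [set x | 0 <= x <= 1 /\ Num.min v M <= G x].

Let Q_neq0 v : [set x | 0 <= x <= 1 /\ Num.min v M <= G x] !=set0.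
Proof. by exists 1; rewrite /= ler01 lexx G_ge1// ge_min lexx orbT. Qed.

Let Q_le v x : 0 <= x <= 1 -> Num.min v M <= G x -> Q v <= x.
Proof.
move=> x01 vx; apply: ge_inf => //.
by exists 0 => y [/andP[]].
Qed.

Let Q01 v : 0 <= Q v <= 1.
Proof.
apply/andP; split; first by apply: lb_le_inf => // y [/andP[]].
by apply: Q_le; rewrite ?ler01 ?lexx// G_ge1// ge_min lexx orbT.
Qed.

Let Q_nd : {homo Q : v w / v <= w}.
Proof.
move=> v w vw; apply: lb_le_inf => // y [y01 wy]; apply: Q_le => //.
by apply: le_trans wy; rewrite le_min !ge_min vw lexx orbT.
Qed.

(** The lower bound is not strict because [G] may jump immediately to the right of [x]. *)
Let Q_cell v x y : 0 < v <= M -> 0 <= y <= 1 -> G x < v <= G y -> x <= Q v <= y.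
Proof.
move=> /andP[v0 vM] y01 /andP[xv vy].
have vMv : Num.min v M = v by apply/min_idPl.
apply/andP; split; last by apply: Q_le => //; rewrite vMv.
apply: lb_le_inf => // w [_]; rewrite vMv leNgt => vw.
rewrite leNgt; apply/negP => wx; case/negP: vw.
by apply: le_lt_trans xv; apply: G_nd; exact: ltW.
Qed.

Lemma kernel01_lipschitz (t : R) : 0 < t -> exists2 K, 0 < K &
  forall u v, 0 <= u <= 1 -> 0 <= v <= 1 ->
    `|kernel01 t u - kernel01 t v| <= K * `|u - v|.
Proof.
(* The denominator of the kernel interpolates between 1 and [t], so [m] bounds it from below. *)
move=> t0; pose m := Num.min 1 t.
have m0 : 0 < m by rewrite lt_min ltr01.
have den u : 0 <= u <= 1 -> m <= 1 + (t - 1) * u.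
  move=> /andP[u0 u1]; have : m <= 1 by rewrite ge_min lexx.
  have : m <= t by rewrite ge_min lexx orbT.
  by nra.
exists (t * (`|t - 1| + 1) / (m * m)).
  by rewrite divr_gt0 ?mulr_gt0// ltr_wpDl.
move=> u v u01 v01; have du := den u u01; have dv := den v v01.
have du0 : 0 < 1 + (t - 1) * u by exact: lt_le_trans du.
have dv0 : 0 < 1 + (t - 1) * v by exact: lt_le_trans dv.
have -> : kernel01 t u - kernel01 t v =
    t * ((t - 1) * (v - u)) / ((1 + (t - 1) * u) * (1 + (t - 1) * v)).
  by rewrite /kernel01; field; rewrite !gt_eqF.
rewrite normrM normfV !normrM (gtr0_norm t0) (gtr0_norm du0) (gtr0_norm dv0).
set a := `|t - 1|; rewrite [`|v - u|]distrC; set e := `|u - v|.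
have a0 : 0 <= a by exact: normr_ge0.
have e0 : 0 <= e by exact: normr_ge0.
apply: (@le_trans _ _ (t * (a * e) / (m * m))).
  apply: ler_wpM2l; first by rewrite !mulr_ge0// ltW.
  by rewrite lef_pV2 ?posrE ?mulr_gt0//; apply: ler_pM => //; exact: ltW.
rewrite [leRHS]mulrAC ler_pM2r ?invr_gt0 ?mulr_gt0// -mulrA ler_pM2l//.
by rewrite ler_wpM2r// lerDl.
Qed.

(** The inverse of the coordinate change [s = 1 / (1 + lambda)]. *)
Let phi (s : R) : \bar R := if s == 0 then +oo%E else ((1 - s) / s)%:E.

Let phi_ge0 s : 0 <= s <= 1 -> (0 <= phi s)%E.
Proof.
move=> /andP[s0 s1]; rewrite /phi; case: eqP => // _.
by rewrite lee_fin divr_ge0// subr_ge0.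
Qed.

Let phi_ni s s' : 0 <= s <= 1 -> 0 <= s' <= 1 -> s <= s' -> (phi s' <= phi s)%E.
Proof.
move=> /andP[s0 s1] /andP[s'0 s'1] ss'; rewrite /phi.
have [_|sn0] := eqVneq s 0; first by rewrite leey.
have {sn0}s0' : 0 < s by rewrite lt_neqAle eq_sym sn0.
have s'0' : 0 < s' by exact: lt_le_trans ss'.
rewrite gt_eqF// lee_fin ler_pdivrMr// mulrAC ler_pdivlMr//.
by rewrite !mulrBl !mul1r [s' * s]mulrC lerB.
Qed.

Let kernel_phi t s : 0 < t -> 0 <= s <= 1 -> kernel_fun t (phi s) = kernel01 t s.
Proof.
move=> t0 /andP[s0 s1]; rewrite /phi /kernel01.
have [->|sn0] := eqVneq s 0; first by rewrite /= mulr0 addr0 divr1.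
have {sn0}s0' : 0 < s by rewrite lt_neqAle eq_sym sn0.
rewrite /=; field.
by rewrite !gt_eqF//=; nra.
Qed.

Let D : set R := `]0, M]%classic.

(* The value [-oo] off [D] keeps the rest of the line out of [0, +oo]. *)
Let rho (v : R) : \bar R := if (0 < v) && (v <= M) then phi (Q v) else -oo%E.

Let rho_measurable : measurable_fun setT rho.
Proof.
apply: measurable_fun_ifT.
- apply: measurable_and; first exact: measurable_fun_ltr.
  exact: measurable_fun_ler.
- apply: nonincreasing_emeasurable => v w vw.
  by apply: phi_ni => //; exact: Q_nd.
- exact: measurable_cst.
Qed.

Let mD : measurable D. Proof. exact: measurable_itv. Qed.

Let M_gt0 : 0 < M. Proof. exact: f_gt0. Qed.

Let D_lty : (@lebesgue_measure R D < +oo)%E.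
Proof. by rewrite lebesgue_measure_itv/= lte_fin M_gt0 -EFinB ltry. Qed.

Let nu : {finite_measure set (measurableTypeR R) -> \bar R} :=
  @mfrestr _ (measurableTypeR R) R D (@lebesgue_measure R) mD D_lty.

Let nu_itv a b : 0 <= a -> a <= b -> b <= M -> nu `]a, b]%classic = (b - a)%:E.
Proof.
move=> a0 ab bM; rewrite /nu/= /mfrestr /mrestr setIidl; last first.
  move=> x /=; rewrite /D/= !in_itv/= => /andP[ax xb].
  by apply/andP; split; [exact: le_lt_trans ax|exact: le_trans bM].
rewrite lebesgue_measure_itv/= lte_fin; case: ltP => [//|ba].
by rewrite (@le_anti _ _ a b) ?ab// subrr.
Qed.

Let nuD : nu D = M%:E.
Proof. by rewrite /D nu_itv// ?subr0// ltW. Qed.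

Let kQ t v := kernel01 t (Q v).

Let kQ_ge0 t v : 0 < t -> 0 <= kQ t v.
Proof. by move=> t0; rewrite /kQ divr_ge0// ltW// kernel01_den_gt0. Qed.

Let kQ_measurable t : 0 < t -> measurable_fun D (fun v => (kQ t v)%:E).
Proof.
move=> t0.
have : measurable_fun D ((fun l => (kernel_fun t l)%:E) \o rho).
  apply: (measurable_comp (F := @ext_halfline R)) => //.
  - exact: emeasurable_itv.
  - move=> _ [v Dv <-]; rewrite /ext_halfline /= /rho; move: Dv; rewrite /D/= in_itv/= => ->.
    by rewrite in_itv/= leey andbT phi_ge0.
  - exact: kernel_fun_measurable.
  - exact: measurable_funTS.
apply: eq_measurable_fun => v; rewrite inE/= /D/= in_itv/= /rho => ->.
by rewrite kernel_phi.
Qed.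

(** The shift by one puts the first point below 0, where [G] vanishes, and point [N.+2] at 1.
    Half-open cells starting at 0 would miss a jump of [G] at 0, that is, an atom at infinity. *)
Let riemann_grid (N : nat) (i : nat) : R := (i%:R - 1) / N.+1%:R.

(** Both sides are within [e] of the same Riemann sum [A], the right one by
    [distribution_riemann_sum], the left one by a step function in [v]; and [e] tends to 0 with the
    mesh. *)
Let integral_kQ t : 0 < t -> (\int[nu]_(v in D) (kQ t v)%:E = (f t)%:E)%E.
Proof.
move=> t0; have [K K0 KL] := kernel01_lipschitz t0.
have approx N : let e := (K / N.+1%:R * M)%R in
    (\int[nu]_(v in D) (kQ t v)%:E <= (f t + (e + e))%:E /\
     (f t)%:E <= \int[nu]_(v in D) (kQ t v)%:E + (e + e)%:E)%E.
  move=> e; pose d := K / N.+1%:R.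
  have N0 : 0 < N.+1%:R :> R by rewrite ltr0Sn.
  have d0 : 0 < d by rewrite divr_gt0.
  pose z := riemann_grid N; pose n := N.+2.
  have znd : {homo z : i j / (i <= j)%N >-> i <= j}.
    by move=> i j ij; rewrite ler_pM2r ?invr_gt0// lerB// ler_nat.
  have z0 : z 0 < 0 by rewrite /z /riemann_grid sub0r pmulr_llt0 ?invr_gt0// ltrN10.
  have zn : 1 <= z n.
    by rewrite /z /riemann_grid /n -natr1 addrK divff// gt_eqF.
  have z01 i : (i < n)%N -> 0 <= z i.+1 <= 1.
    move=> iN; rewrite /z /riemann_grid -natr1 addrK divr_ge0//=.
    by rewrite ler_pdivrMr// mul1r ler_nat.
  have zS i : z i.+1 - z i = N.+1%:R^-1.
    by rewrite /z /riemann_grid -natr1; field; rewrite gt_eqF.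
  pose c i := kernel01 t (z i.+1).
  have cell i u : (i < n)%N -> 0 <= u <= 1 -> z i <= u <= z i.+1 ->
      `|kernel01 t u - c i| <= d.
    move=> iN u01 /andP[iu ui]; apply: le_trans (KL _ _ u01 (z01 i iN)) _.
    rewrite ler_pM2l// distrC ger0_norm ?subr_ge0// -(zS i).
    by rewrite lerB.
  have c0 i : (i < n)%N -> 0 <= c i.
    move=> iN; have := z01 i iN => zi.
    by rewrite /c divr_ge0// ltW// kernel01_den_gt0.
  pose A := \sum_(i < n) c i * (G (z i.+1) - G (z i)).
  have Af : `|A - f t| <= e.
    apply: distribution_riemann_sum => // i u iN u01 /andP[iu ui].
    by apply: cell => //; rewrite (ltW iu).
  (* For [v] in the cell between two values of [G], [Q v] lies between the corresponding grid
     points, and the cell has [nu]-measure the increment of [G]. So [S] approximates [kQ t] and has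
     integral [A]. *)
  pose S v := \sum_(i < n) c i * \1_(`]G (z i), G (z i.+1)]%classic) v.
  have S0 v : 0 <= S v.
    by apply: sumr_ge0 => i _; apply: mulr_ge0; [exact: c0|rewrite indicE].
  have Sapp v : D v -> `|S v - kQ t v| <= d.
    rewrite /D/= in_itv/= => vD; have /andP[v0 vM] := vD.
    have -> : S v = \sum_(i < n) c i * ((v <= G (z i.+1))%R%:R - (v <= G (z i))%R%:R).
      apply: eq_bigr => i _; congr (_ * _); rewrite indicE mem_setE in_itv/=.
      rewrite ltNge; case: (boolP (v <= G (z i))) => /= vw; last by rewrite subr0.
      by rewrite (le_trans vw) ?subrr// G_nd// znd.
    apply: (@step_approximation _ _ (G \o z)).
    - by move=> i j ij; apply: G_nd; exact: znd.
    - by rewrite /= G_lt0// v0 G_ge1.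
    - move=> i iN iv; apply: cell => //.
      exact: Q_cell (z01 i iN) iv.
  have mS : measurable_fun D (fun v => (S v)%:E).
    apply/measurable_EFinP; apply: measurable_sum => i.
    exact: measurable_funM.
  have IS : (\int[nu]_(v in D) (S v)%:E = A%:E)%E.
    under eq_integral do rewrite /S -sumEFin.
    rewrite ge0_integral_sum//.
    - rewrite /A -sumEFin; apply: eq_bigr => i _.
      under eq_integral do rewrite EFinM.
      rewrite ge0_integralZl_EFin//; last 2 first.
        by apply/measurable_EFinP; exact: measurable_indic.
      exact: c0.
      rewrite integral_indic//.
      rewrite setIidl; last first.
        move=> x/=; rewrite /D/= !in_itv/= => /andP[ax xb].
        by apply/andP; split; [exact: le_lt_trans ax|exact: le_trans xb (G_leM _)].
      rewrite [RHS]EFinM; congr (_ * _)%E.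
      by apply: nu_itv => //; apply: G_nd; exact: znd.
    - move=> i; apply/measurable_EFinP; exact: measurable_funM.
    - by move=> i v _; rewrite lee_fin mulr_ge0 ?c0// indicE.
  have shift (g : R -> R) : measurable_fun D (fun v => (g v)%:E) -> (forall v, 0 <= g v) ->
      (\int[nu]_(v in D) (g v + d)%:E = \int[nu]_(v in D) (g v)%:E + e%:E)%E.
    move=> mg g0; under eq_integral do rewrite EFinD.
    rewrite ge0_integralD//.
    - have -> : e%:E = (d%:E * M%:E)%E by rewrite -EFinM.
      by rewrite integral_cst//; congr (_ + _ * _)%E; exact: nuD.
    - by move=> v _; rewrite lee_fin.
    - by move=> v _; rewrite lee_fin ltW.
  split.
    apply: (@le_trans _ _ (\int[nu]_(v in D) (S v + d)%:E)%E).
      apply: ge0_le_integral => //.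
      - by move=> v _; rewrite lee_fin kQ_ge0.
      - exact: kQ_measurable.
      - by apply/measurable_EFinP/measurable_funD => //; exact/measurable_EFinP.
      - move=> v Dv; rewrite lee_fin.
        by have := Sapp v Dv; rewrite ler_norml => /andP[+ _]; lra.
    rewrite shift// IS -EFinD lee_fin.
    by move: Af; rewrite ler_norml => /andP[_]; lra.
  rewrite EFinD addeA -shift//; last 2 first.
  - exact: kQ_measurable.
  - by move=> v; exact: kQ_ge0.
  apply: (@le_trans _ _ (\int[nu]_(v in D) (S v)%:E + e%:E)%E).
    rewrite IS -EFinD lee_fin.
    by move: Af; rewrite ler_norml => /andP[+ _]; lra.
  rewrite leeD2r//; apply: ge0_le_integral => //.
  - by move=> v _; rewrite lee_fin.
  - apply/measurable_EFinP/measurable_funD => //.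
    by apply/measurable_EFinP; exact: kQ_measurable.
  - move=> v Dv; rewrite lee_fin.
    by have := Sapp v Dv; rewrite ler_norml => /andP[_]; lra.
have small e : 0 < e -> exists N, (K / N.+1%:R * M) + (K / N.+1%:R * M) <= e.
  move=> e0; exists (Num.truncn ((K * M + K * M) / e)).
  have := truncnS_gt ((K * M + K * M) / e).
  rewrite ltr_pdivrMr// => /ltW h.
  rewrite mulrAC -mulrDl ler_pdivrMr ?ltr0Sn//.
  by rewrite [leRHS]mulrC.
apply/eqP; rewrite eq_le; apply/andP; split; apply/lee_addgt0Pr => e e0;
  have [N Ne] := small e e0.
  by apply: le_trans (approx N).1 _; rewrite -EFinD lee_fin lerD2l.
by apply: le_trans (approx N).2 _; rewrite leeD2l// lee_fin.
Qed.

Lemma representing_measure :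
  exists mu : {finite_measure set (\bar R) -> \bar R},
    on_ext_halfline mu /\ represents mu f.
Proof.
pose mu : {finite_measure set (\bar R) -> \bar R} :=
  fin_pushforward nu rho_measurable.
have rhoE : rho @^-1` (@ext_halfline R) = D.
  apply/seteqP; split => v; rewrite /ext_halfline/= /D/= !in_itv/= /rho.
    by case: ifP => //.
  by move=> ->; rewrite leey andbT phi_ge0.
exists mu; split; rewrite /on_ext_halfline.
  have -> : mu (~` (@ext_halfline R)) = nu (rho @^-1` (~` (@ext_halfline R))) by [].
  have -> : rho @^-1` (~` (@ext_halfline R)) = ~` D by rewrite -rhoE.
  by rewrite /nu/= /mfrestr /mrestr setICl measure0.
move=> t t0; rewrite -(integral_kQ t0).
rewrite ge0_integral_pushforward//; last 3 first.
- exact: emeasurable_itv.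
- exact: kernel_fun_measurable.
- by move=> l; rewrite inE lee_fin => /(kernel_fun_bounds t0)/andP[].
rewrite rhoE; apply: eq_integral => v; rewrite inE/= /D/= in_itv/= /rho => ->.
by rewrite kernel_phi.
Qed.

End RepresentingMeasure.

(** * Operator monotonicity of the kernels *)

Section KernelMonotone.
Local Open Scope sesquilinear_scope.
Context {R : realType}.

Definition dotc n (v w : 'cV[R[i]]_n) : R[i] := (w^t* *m v) 0 0.

Lemma unitary_dotc n (u : 'M[R[i]]_n) (v w : 'cV_n) : u \is unitarymx ->
  \sum_k (u *m v) k 0 * ((u *m w) k 0)^* = dotc v w.
Proof.
move=> uU; rewrite /dotc.
have -> : w^t* *m v = (u *m w)^t* *m (u *m v).
  rewrite trmx_mul map_mxM/= !mulmxA -[_ *m u^t* *m u]mulmxA.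
  by rewrite -(invmx_unitary uU) mulVmx ?mulmx1// unitarymx_unit.
by rewrite [RHS]mxE; apply: eq_bigr => k _; rewrite !mxE mulrC.
Qed.

(** The weights are the squared moduli of the coordinates of [u *m v]. They do not depend on [g], so
    one choice serves [f] and all kernels under the integral. *)
Lemma unitary_diag_qform_real n (u : 'M[R[i]]_n) (d : 'rV[R]_n) (v : 'cV_n) :
  u \is unitarymx -> exists2 a : 'I_n -> R, (forall k, 0 <= a k) &
  forall g, qform (unitary_diag u (map_mx g d)) v = (\sum_k g (d 0 k) * a k)%:C%C.
Proof.
move=> uU; pose z k := (u *m v) k 0.
have zE k : z k * (z k)^* = (complex.Re (z k * (z k)^*))%:C%C.
  have : 0 <= z k * (z k)^* by exact: mul_conjC_ge0.
  by move=> /ger0_real/complex_realP[r ->].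
exists (fun k => complex.Re (z k * (z k)^*)) => [k|g].
  by rewrite -lecR -zE mul_conjC_ge0.
rewrite (unitary_diag_qform _ _ uU) rmorph_sum/=; apply: eq_bigr => k _.
by rewrite mxE -/(z k) zE -rmorphM.
Qed.

(* Minimal in [w] at [w = (x + r)^-1 v], where its value is the quadratic form of
   [x (x + r)^-1] at [v]; for fixed [w] it is monotone in [x]. *)
Definition variation (r : R) n (x : 'M[R[i]]_n) (v w : 'cV[R[i]]_n) : R[i] :=
  dotc v v - r%:C%C * (dotc v w + dotc w v) + r%:C%C * (qform x w + r%:C%C * dotc w w).

(** Completion of the square in each eigencoordinate. *)
Lemma variation_diag r n (u : 'M[R[i]]_n) (d : 'rV[R]_n) (v w : 'cV_n) :
  u \is unitarymx -> 0 <= r -> (forall k, 0 < d 0 k) ->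
  variation r (unitary_diag u d) v w =
  qform (unitary_diag u (map_mx (fun t => t / (t + r)) d)) v +
  \sum_k (r * (d 0 k + r))%:C%C *
    (((u *m w) k 0 - ((d 0 k + r)^-1)%:C%C * (u *m v) k 0) *
     ((u *m w) k 0 - ((d 0 k + r)^-1)%:C%C * (u *m v) k 0)^*).
Proof.
move=> uU r0 d0; rewrite /variation !(unitary_diag_qform _ _ uU) -!(unitary_dotc _ _ uU).
have sumE (p : R[i]) (a b c a' b' : 'I_n -> R[i]) :
    \sum_k a k - p * (\sum_k b k + \sum_k c k) + p * (\sum_k a' k + p * \sum_k b' k) =
    \sum_k (a k - p * (b k + c k) + p * (a' k + p * b' k)).
  by rewrite big_split/= sumrB -!mulr_sumr !big_split/= -mulr_sumr.
rewrite sumE -big_split/=; apply: eq_bigr => k _.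
set z := (u *m v) k 0; set s := (u *m w) k 0; rewrite mxE.
(* With the inverse [q] as the variable, [d 0 k] is [q^-1 - r] and a single nonvanishing condition
   remains for [field]. *)
have [q qE] : exists q, q = (d 0 k + r)^-1 by exists (d 0 k + r)^-1.
have q0 : q != 0 by rewrite qE invr_eq0 gt_eqF// ltr_wpDr.
have -> : d 0 k = q^-1 - r by rewrite qE invrK addrK.
have qc0 : q%:C%C != 0 :> R[i] by rewrite fmorph_eq0.
rewrite subrK invrK.
have -> : (s - q%:C%C * z)^* = s^* - q%:C%C * z^*.
  by rewrite rmorphB rmorphM/= conj_realC.
have -> : ((q^-1 - r) * q)%:C%C = 1 - r%:C%C * q%:C%C :> R[i].
  by rewrite mulrBl mulVf// rmorphB rmorphM.
rewrite [in X in _ = _ + X]rmorphM rmorphB/= fmorphV/=.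
by field.
Qed.

(** With [s] the minimizer for the larger matrix, the right side is its variation at [s]. This
    dominates the variation of the smaller matrix at [s], which exceeds the left side by a sum of
    nonnegative squares. *)
Lemma kernel_qform_monotone r n (u w : 'M[R[i]]_n) (d e : 'rV[R]_n) (v : 'cV_n) :
  u \is unitarymx -> w \is unitarymx -> 0 <= r ->
  (forall k, 0 < d 0 k) -> (forall k, 0 < e 0 k) ->
  (forall v, qform (unitary_diag u d) v <= qform (unitary_diag w e) v) ->
  qform (unitary_diag u (map_mx (fun t => t / (t + r)) d)) v <=
  qform (unitary_diag w (map_mx (fun t => t / (t + r)) e)) v.
Proof.
move=> uU wU r0 d0 e0 xy.
pose s := unitary_diag w (map_mx (fun t => (t + r)^-1) e) *m v.
have sE : w *m s = diag_mx (map_mx (fun t => ((t + r)^-1)%:C%C) e) *m (w *m v).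
  have E : map_mx (fun t => ((t + r)^-1)%:C%C) e =
      map_mx (fun t => t%:C%C) (map_mx (fun t => (t + r)^-1) e).
    by apply/rowP => k; rewrite !mxE.
  by rewrite /s /unitary_diag !mulmxA mulmxV ?unitarymx_unit// mul1mx E.
have -> : qform (unitary_diag w (map_mx (fun t => t / (t + r)) e)) v =
    variation r (unitary_diag w e) v s.
  rewrite (variation_diag _ _ wU r0 e0) [X in _ + X]big1 ?addr0// => k _.
  rewrite sE mul_diag_mx !mxE -/(_ *m _).
  by rewrite subrr mul0r mulr0.
apply: (@le_trans _ _ (variation r (unitary_diag u d) v s)).
  rewrite (variation_diag _ _ uU r0 d0) lerDl; apply: sumr_ge0 => k _.
  apply: mulr_ge0; last exact: mul_conjC_ge0.
  by rewrite lecR mulr_ge0// addr_ge0// ltW.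
rewrite /variation lerD2l; apply: ler_wpM2l; first by rewrite lecR.
by rewrite lerD2r; exact: xy.
Qed.

Lemma represents_sum (mu : {finite_measure set (\bar R) -> \bar R}) (f : R -> R)
    n (d : 'rV[R]_n) (a : 'I_n -> R) :
  represents mu f -> (forall k, 0 < d 0 k) -> (forall k, 0 <= a k) ->
  ((\sum_k f (d 0 k) * a k)%:E =
   \int[mu]_(l in ext_halfline) (\sum_k kernel_fun (d 0 k) l * a k)%:E)%E.
Proof.
move=> fmu d0 a0; have mext : measurable (@ext_halfline R) by exact: emeasurable_itv.
under [RHS]eq_integral do rewrite -sumEFin.
rewrite ge0_integral_sum//.
- rewrite -sumEFin; apply: eq_bigr => k _.
  rewrite EFinM fmu// muleC -ge0_integralZl_EFin//.
  + by apply: eq_integral => l _; rewrite -EFinM mulrC.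
  + by move=> l /(kernel_fun_bounds (d0 k))/andP[]; rewrite lee_fin.
  + exact: kernel_fun_measurable.
- move=> k; apply/measurable_EFinP/measurable_funM => //.
  exact/measurable_EFinP/kernel_fun_measurable.
- move=> k l /(kernel_fun_bounds (d0 k))/andP[k0 _].
  by rewrite lee_fin mulr_ge0.
Qed.

(** The inequality of quadratic forms holds under the integral for each [l]: for finite [l] it is
    [kernel_qform_monotone] times [1 + r], and at infinity, where the kernel is the identity
    function, it is the hypothesis on [x] and [y]. *)
Lemma represents_operator_monotone (mu : {finite_measure set (\bar R) -> \bar R})
  (f : R -> R) : represents mu f -> operator_monotone `]0, +oo[ f.
Proof.
move=> fmu n x y xh yh xI yI.
have [u [d [uU -> dI]]] := herm_unitary_diag xh xI.
have [w [e [wU -> eI]]] := herm_unitary_diag yh yI.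
have d0 k : 0 < d 0 k by have := dI k; rewrite in_itv/= andbT.
have e0 k : 0 < e 0 k by have := eI k; rewrite in_itv/= andbT.
move=> /(lemxP (unitary_diag_herm _ uU) (unitary_diag_herm _ wU)) xy.
rewrite (fun_calc_diag _ _ uU) (fun_calc_diag _ _ wU).
apply/(lemxP (unitary_diag_herm _ uU) (unitary_diag_herm _ wU)) => v.
have [a a0 aE] := unitary_diag_qform_real d v uU.
have [b b0 bE] := unitary_diag_qform_real e v wU.
rewrite aE bE lecR -lee_fin (represents_sum fmu d0 a0) (represents_sum fmu e0 b0).
have mext : measurable (@ext_halfline R) by exact: emeasurable_itv.
have sum_measurable m (c : 'rV[R]_m) (h : 'I_m -> R) : (forall k, 0 < c 0 k) ->
    measurable_fun (@ext_halfline R) (fun l => (\sum_k kernel_fun (c 0 k) l * h k)%:E).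
  move=> c0; apply/measurable_EFinP; apply: measurable_sum => k.
  by apply: measurable_funM => //; exact/measurable_EFinP/kernel_fun_measurable.
apply: ge0_le_integral => //.
- move=> l lext; rewrite lee_fin; apply: sumr_ge0 => k _.
  by have /andP[k0 _] := kernel_fun_bounds (d0 k) lext; rewrite mulr_ge0.
- exact: sum_measurable.
- exact: sum_measurable.
move=> [r| |]; rewrite /ext_halfline/= in_itv/= ?lee_fin//.
  rewrite leey andbT => r0.
  have := kernel_qform_monotone v uU wU r0 d0 e0 xy; rewrite aE bE lecR => H.
  have r1 : 0 <= 1 + r by exact: addr_ge0.
  have := ler_wpM2l r1 H; rewrite !mulr_sumr; congr (_ <= _);
    by apply: eq_bigr => k _; ring.
have idE m (c : 'rV[R]_m) : map_mx id c = c by apply/matrixP => i j; rewrite mxE.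
by move=> _; have := xy v; have := aE id; have := bE id; rewrite !idE => -> ->; rewrite lecR.
Qed.

(** At [t = 1] the kernel is constantly 1. *)
Lemma represents_total_mass (mu : {finite_measure set (\bar R) -> \bar R})
  (f : R -> R) : represents mu f -> (f 1)%:E = mu (@ext_halfline R).
Proof.
move=> fmu; rewrite (fmu 1 ltr01).
have mext : measurable (@ext_halfline R) by exact: emeasurable_itv.
rewrite (eq_integral (cst 1%E)) ?integral_cst ?mul1e//.
move=> [r| |]; rewrite inE /ext_halfline/= in_itv/= ?lee_fin//.
move=> /andP[r0 _]; rewrite mul1r divff// gt_eqF//.
by rewrite ltr_wpDr.
Qed.

End KernelMonotone.

Theorem corollary5p1 (R : realType) :
  [/\ (forall f : R -> R,
         (forall t : R, 0 < t -> 0 < f t) ->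
         operator_monotone `]0, +oo[ f ->
         exists mu : {finite_measure set (\bar R) -> \bar R},
           on_ext_halfline mu /\ represents mu f),
      (forall (f : R -> R) (mu : {finite_measure set (\bar R) -> \bar R}),
         on_ext_halfline mu -> represents mu f ->
         operator_monotone `]0, +oo[ f)
    & (forall (f : R -> R) (mu : {finite_measure set (\bar R) -> \bar R}),
         on_ext_halfline mu -> represents mu f ->
         (mu ext_halfline = 1%E <-> f 1 = 1))].
Proof.
split.
- move=> f f0 fm; have [G GP] := distribution_function f0 fm.
  exact: representing_measure f0 GP.
- by move=> f mu _; exact: represents_operator_monotone.
- move=> f mu _ fmu; rewrite -(represents_total_mass fmu).
  by split=> [[]|->].
Qed.
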